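(* Let $w_n\in\mathbb{YF}_n$ for $n=1,2,\dots$, and let $\psi_{w_n}$ be the linear functional on $R_n$ defined by $\psi_{w_n}(s_v)=\delta_{v,w_n}/d(w_n)$ for $v\in\mathbb{YF}_n$. If the sequence $(w_n)$ satisfies the regularity conditions, then the sequence $(\psi_{w_n})$ is regular; more precisely, if condition (i) holds then $\lim_{n\to\infty}\psi_{w_n}(QX^{n-m})=\varphi_P(Q)$, and if condition (ii) holds (with infinite word $w$ and constant $\beta$) then $\lim_{n\to\infty}\psi_{w_n}(QX^{n-m})=\varphi_{\beta,w}(Q)$, for every $m\ge1$ and every $Q\in R_m$. Conversely, if the sequence $(\psi_{w_n})$ is regular, then $(w_n)$ satisfies the regularity conditions.
   Context: Fibonacci words are finite words in $\{1,2\}$; rank $|v|$ = sum of digits; $\mathbb{YF}_n$ = words of rank $n$. Head of $v$ = maximal block of 2's at its left end. $v\nearrow w$ iff $w$ arises from $v$ by: adding a 1 at the left end; replacing the leftmost 1 by 2; or inserting a 1 between two consecutive 2's of the head or right after the last 2 of the head. $d(u,v)$ = number of chains $u=x_0\nearrow\cdots\nearrow x_r=v$; $d(v)=d(\varnothing,v)$. Position of the 2 in $v=v_12v_2$ is $|v_2|+1$. Okada ring $R=\mathbb Q\langle X,Y\rangle$, $\deg X=1$, $\deg Y=2$, degree-$n$ part $R_n$. Noncommutative determinant $\det(a_{ij})=\sum_{\sigma}\mathrm{sgn}(\sigma)a_{\sigma(1)1}\cdots a_{\sigma(n)n}$. $P_n$ ($P_0=1$): $n\times n$ tridiagonal determinant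 with $X$ on diagonal, $Y$ on superdiagonal, $1$ on subdiagonal; $Q_{n-1}$ ($n\ge1$): the determinant of the matrix of $P_n$ with first row replaced by $(Y,Y,0,\dots,0)$ and second row by $(X,X,Y,0,\dots,0)$ ($Q_0=Y$). For $v=1^{k_t}21^{k_{t-1}}2\cdots1^{k_1}21^{k_0}$: $s_v=P_{k_0}Q_{k_1}\cdots Q_{k_t}$, $p_v=\prod_{i=0}^{t-1}(X^{k_i+2}-(k_i+2)X^{k_i}Y)\cdot X^{k_t}$ (factors in order $i=0,\dots,t-1$). $\{s_v\}_{|v|=n}$ and $\{p_v\}_{|v|=n}$ are bases of $R_n$. A sequence of linear functionals $\psi_n$ on $R_n$ is regular if there is a linear functional $\varphi$ on $R$ with $\lim_n\psi_n(QX^{n-m})=\varphi(Q)$ for every $m$ and every $Q\in R_m$. Infinite words $w=\cdots a_2a_1$ extend to the left; position of a 2 at $a_i$ is $1+\sum_{l<i}a_l$. A sequence of finite words with ranks $\to\infty$ converges to $w$ if for every $m$ the $m$-th letter from the right of $w_n$ equals $a_m$ for all but finitely many $n$. $w$ is summable if $\sum_j1/d_j<\infty$ over positions $d_j$ of its 2's. For a finite or summable word $v$, $\pi(v)=\prod_{j:d_j\ge2}(1-1/d_j)$. Regularity conditions on $(w_n)$: (i) $\lim_n\pi(w_n)=0$; or (ii) $w_n$ converges to a summable infinite word $w$ and the limit $\beta=\pi(w)^{-1}\lim_n\pi(w_n)$ exists and is $>0$. Functionals: $\varphi_P$ is the linear functional on $R$ with $\varphi_P(s_v)=d(v)/|v|!$.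 For summable $w$, $\varphi_w$ is the linear functional on $R$ with $\varphi_w(p_u)=\prod_{i=1}^m\prod_{j:\delta_i\le d_j<\delta_{i+1}}(1-\frac{\delta_i+1}{d_j})$ for all finite words $u$ ($\delta_1<\dots<\delta_m$ positions of 2's in $u$, $\delta_{m+1}=\infty$, $d_j$ positions of 2's in $w$). With $\varphi_w(v):=\varphi_w(s_v)$, and $C_\beta(\varphi)(v)=\sum_{k=0}^{|v|}\frac{\beta^k(1-\beta)^{|v|-k}}{(|v|-k)!}\sum_{|u|=k}\varphi(u)d(u,v)$, $\varphi_{\beta,w}$ is the linear functional on $R$ with $\varphi_{\beta,w}(s_v)=C_\beta(\varphi_w)(v)$. *)

(* Defs.v *)
From HB Require Import structures.
From mathcomp Require Import all_boot all_order all_algebra all_fingroup.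
From mathcomp Require Import finmap.
From mathcomp.multinomials Require Import monalg.
From mathcomp Require Import all_classical all_reals all_analysis.

Set Implicit Arguments.
Unset Strict Implicit.
Unset Printing Implicit Defensive.

Import Order.TTheory GRing.Theory Num.Theory.
Import numFieldNormedType.Exports.

Local Open Scope classical_set_scope.
Local Open Scope ring_scope.

(* A digit is a boolean, [false] standing for 1 and [true] for 2.  A finite
   word is a sequence whose first element is the leftmost digit; an infinite
   word [W] lists its digits from the right, [W i] being a_(i+1). *)
Notation word := (seq bool).
Notation infword := (nat -> bool).

Definition wdigit (b : bool) : nat := b.+1.

Definition wrank (v : seq bool) : nat := (\sum_(b <- v) wdigit b)%N.

Definition YF (n : nat) : set word := [set v | wrank v = n].

Definition head_size (v : word) : nat := index false v.

(* [yfcover v w] is v ↗ w. *)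
Definition yfcover (v w : word) : bool :=
  let h := head_size v in
  [|| w == false :: v,
      (h < size v)%N && (w == set_nth false v h true)
    | has (fun i => w == take i v ++ false :: drop i v) (iota 1 h)].

Definition chains (u v : word) : set (seq word) :=
  [set c | path yfcover u c /\ last u c = v].

(* [fset_set A] is the finite set A when A is finite, which [chains u v] is
   because each step increases the rank by 1. *)
Definition dim_between (u v : word) : nat := #|` fset_set (chains u v)|.

Definition dim (v : word) : nat := dim_between [::] v.

(* Positions of the 2's of a finite word, in increasing order. *)
Fixpoint twos (v : word) : seq nat :=
  if v is b :: v' then
    if b then rcons (twos v') (wrank v').+1 else twos v'
  else [::].

Definition wpos (W : infword) (i : nat) : nat :=
  (1 + \sum_(l < i) wdigit (W l))%N.

(* For v = 1^{k_t} 2 1^{k_(t-1)} 2 ... 2 1^{k_0}: the sequence k_t, ..., k_0. *)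
Fixpoint lblocks (v : word) : seq nat :=
  if v is b :: v' then
    if b then 0%N :: lblocks v'
    else (head 0%N (lblocks v')).+1 :: behead (lblocks v')
  else [:: 0%N].

Definition ntwos (v : word) : nat := count_mem true v.

Definition block (v : word) (i : nat) : nat := nth 0%N (rev (lblocks v)) i.

(* Monomials in X and Y are words in [false] (for X) and [true] (for Y), so
   that the degree of a monomial is its [wrank]. *)
Definition okada := {malg rat[{fmonom bool}]}.

Definition oX : okada := mkmalgU (fmu false) 1.
Definition oY : okada := mkmalgU (fmu true) 1.

Definition okada_deg (n : nat) : set okada :=
  [set x | forall m : {fmonom bool}, m \in msupp x -> wrank m = n].

(* [\prod_(j < n)] multiplies in increasing order of j. *)
Definition ncdet (n : nat) (A : 'M[okada]_n) : okada :=
  \sum_(s : 'S_n) (-1) ^+ s * \prod_(j < n) A (s j) j.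

(* Rows and columns are numbered from 0. *)
Definition Pentry (i j : nat) : okada :=
  if i == j then oX else
  if j == i.+1 then oY else
  if i == j.+1 then 1 else 0.

Definition Qentry (i j : nat) : okada :=
  match i with
  | 0 => if (j <= 1)%N then oY else 0
  | 1 => if (j <= 1)%N then oX else if j == 2%N then oY else 0
  | _ => Pentry i j
  end.

Definition okada_P (n : nat) : okada := ncdet (\matrix_(i < n, j < n) Pentry i j).

Definition okada_Q (k : nat) : okada :=
  ncdet (\matrix_(i < k.+1, j < k.+1) Qentry i j).

Definition okada_s (v : word) : okada :=
  okada_P (block v 0) * \prod_(1 <= i < (ntwos v).+1) okada_Q (block v i).

Definition okada_p (v : word) : okada :=
  (\prod_(0 <= i < ntwos v)
     (oX ^+ (block v i).+2 - (block v i).+2%:R * oX ^+ block v i * oY))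
  * oX ^+ block v (ntwos v).

Section Functionals.
Variable R : realType.
Implicit Types (v u : word) (W : infword).

(* A linear functional on a subspace D of the Okada ring is represented by a
   function on the whole ring, whose values outside D are irrelevant. *)
Definition linear_on (D : set okada) (f : okada -> R) : Prop :=
  forall (a : rat) (x y : okada), D x -> D y ->
    f (a *: x + y) = ratr a * f x + f y.

(* The linear functional on D sending the basis (b v), v in I, of D to val. *)
Definition functional (D : set okada) (I : set word) (b : word -> okada)
    (val : word -> R) : okada -> R :=
  get [set f | linear_on D f /\ forall v, I v -> f (b v) = val v].

Definition regular (psi : nat -> okada -> R) : Prop :=
  exists phi : okada -> R, linear_on setT phi /\
    forall (m : nat) (Q : okada), okada_deg m Q ->
      psi n (Q * oX ^+ (n - m)) @[n --> \oo] --> phi Q.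

Definition converges_to (w : nat -> word) W : Prop :=
  forall m : nat, \forall n \near \oo, onth (rev (w n)) m = Some (W m).

Definition summable_word W : Prop :=
  cvgn (series (fun i => if W i then (wpos W i)%:R^-1 else 0 : R)).

Definition pi_fin v : R := \prod_(d <- twos v | (2 <= d)%N) (1 - d%:R^-1).

Definition pi_inf W : R :=
  limn (fun N => \prod_(i < N | W i && (2 <= wpos W i)%N)
                   (1 - (wpos W i)%:R^-1) : R).

Definition condition_i (w : nat -> word) : Prop :=
  pi_fin (w n) @[n --> \oo] --> (0 : R).

Definition condition_ii (w : nat -> word) W (beta : R) : Prop :=
  [/\ converges_to w W, summable_word W,
      cvgn (fun n => pi_fin (w n)),
      beta = (pi_inf W)^-1 * limn (fun n => pi_fin (w n))
    & 0 < beta].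

Definition regularity_conditions (w : nat -> word) : Prop :=
  condition_i w \/ exists W beta, condition_ii w W beta.

Definition psi (n : nat) (w : word) : okada -> R :=
  functional (okada_deg n) (YF n) okada_s (fun v => (v == w)%:R / (dim w)%:R).

Definition phi_P : okada -> R :=
  functional setT setT okada_s (fun v => (dim v)%:R / ((wrank v)`!)%:R).

(* The last range of positions, from delta_m on, is unbounded. *)
Definition phi_w_val W u : R :=
  let delta := twos u in
  let m := size delta in
  \prod_(0 <= i < m)
    limn (fun N =>
      \prod_(l < N | [&& W l, (nth 0%N delta i <= wpos W l)%N
                       & (i.+1 < m)%N ==> (wpos W l < nth 0%N delta i.+1)%N])
        (1 - (nth 0%N delta i).+1%:R / (wpos W l)%:R) : R).

Definition phi_w W : okada -> R := functional setT setT okada_p (phi_w_val W).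

Definition C_beta (beta : R) (phi : word -> R) v : R :=
  \sum_(0 <= k < (wrank v).+1)
    beta ^+ k * (1 - beta) ^+ (wrank v - k) / ((wrank v - k)`!)%:R
    * \sum_(u \in YF k) phi u * (dim_between u v)%:R.

Definition phi_beta_w (beta : R) W : okada -> R :=
  functional setT setT okada_s (C_beta beta (fun v => phi_w W (okada_s v))).

End Functionals.

(* Main.v *)
(* The functional [psi n w] sends f in R_n to the coefficient of [s_w] in f,
   divided by [d(w)].  Its values are computed in the basis p rather than s:
   transposing right multiplication by X and Y gives operators on functions of
   words, and by the relation DU - UD = 1 the adjoint of U acts on the factors of
   [p_u] as the derivation that kills all of them but the trailing power of X.
   Peeling the digits of w off the left one by one, the value on [p_u X^(n-m)]
   becomes a product over the positions d of the 2's of w of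
   [1 - (delta + 1) / d], delta being the last position of a 2 in u that is at
   most d; the same rules evaluate [phi_P] and [phi_beta_w] on p.

   With r the largest delta + 1, the quotient [(1 - r/d) / (1 - 1/d)^r] is
   1 + O(1/d^2), so the product is [m(w) * pi(w)^r] with m continuous for the
   convergence of words.  This gives both limits.

   Conversely, let [c_k] be the limit for the word u with a single 2, at position
   k + 1.  If [c_0 = c_1 = 0] then [pi(w n)] tends to 0, since 2 and 3 are never
   both positions of 2's.  Otherwise [pi(w n)] stays away from 0; then [c_k < 0]
   exactly when k + 1 is eventually a position of a 2, which determines the limit
   word, and [pi(w n)^r] converges because m does. *)
Require Import Defs.
From mathcomp Require Import all_boot all_order all_algebra all_fingroup.
From mathcomp Require Import finmap.
From mathcomp.multinomials Require Import monalg.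
From mathcomp Require Import all_classical all_reals all_analysis.
From mathcomp Require Import ring lra zify.
Import Order.TTheory GRing.Theory Num.Theory.
Import numFieldNormedType.Exports.
Local Open Scope classical_set_scope.
Local Open Scope ring_scope.
Set Implicit Arguments.
Unset Strict Implicit.
Unset Printing Implicit Defensive.

(** * Words and chains *)

Lemma wrank_nil : wrank [::] = 0%N.
Proof. by rewrite /wrank big_nil. Qed.

Lemma wrank_cons b v : wrank (b :: v) = (b.+1 + wrank v)%N.
Proof. by rewrite /wrank big_cons. Qed.

Lemma wrank_cat u v : wrank (u ++ v) = (wrank u + wrank v)%N.
Proof. by rewrite /wrank big_cat. Qed.

Lemma wrank_eq0 v : wrank v = 0%N -> v = [::].
Proof. by case: v => [//|b v]; rewrite wrank_cons. Qed.

(** The words covered by [v]. A word starting with 1 covers only its tail, while the words covered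
    by 2v' are exactly those that cover v'; so [upper v] is convertible to [lower (true :: v)]. *)
Fixpoint lower (v : word) : seq word :=
  if v is b :: v' then
    if b then (false :: v') :: map (cons true) (lower v') else [:: v']
  else [::].

Definition upper (v : word) : seq word :=
  (false :: v) :: map (cons true) (lower v).

Lemma mem_map_cons (b : bool) (x : word) (s : seq word) :
  (x \in map (cons b) s) = if x is c :: x' then (c == b) && (x' \in s) else false.
Proof.
case: x => [|c x]; first by apply/mapP => -[].
apply/mapP/andP => [[y ys [-> ->]]|[/eqP -> xs]]; first by rewrite eqxx.
by exists x.
Qed.

Lemma mem_upper v w :
  (w \in upper v) = if w is b :: w' then if b then w' \in lower v else w' == v
                    else false.
Proof.
rewrite /upper inE mem_map_cons; by case: w => [|[] w] //=; rewrite eqseq_cons orbF.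
Qed.

(** Removing a leading 2 from [w] exchanges the roles of the two words, hence the induction on their
    total length. *)
Lemma mem_upper_lower v w : (w \in upper v) = (v \in lower w).
Proof.
have [n] := ubnP (size v + size w); elim: n v w => // n IH v w.
rewrite mem_upper; case: w => [//|[] w] /= hs; last by rewrite inE eq_sym.
by rewrite -[(_ :: _)]/(upper w) IH //; move: hs; rewrite addnS addnC.
Qed.

(** A common leading 2 can be removed: inserting a 1 right after it becomes adding a 1 at the left
    end of the tail, and the moves further right stay what they are. *)
Lemma yfcoverE v w : yfcover v w = (v \in lower w).
Proof.
rewrite -mem_upper_lower mem_upper; elim: v w => [|[] v IH] w.
- by rewrite /yfcover /= orbF; case: w => [|[] w] //=; rewrite eqseq_cons.
- rewrite /yfcover /= -[2%N]/(1 + 1)%N iotaDl has_map take0 drop0.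
  case: w => [|[] w] /=.
  + by rewrite andbF /=; apply/negbTE/hasPn.
  + rewrite -[_ \in _]/(w \in upper v) mem_upper -IH /yfcover orbCA.
    rewrite !eqseq_cons /=; congr [|| _, _ | _].
  + rewrite !eqseq_cons /= andbF orFb.
    rewrite (_ : has _ _ = false) ?orbF //; exact/negbTE/hasPn.
- rewrite /yfcover /= orbF; case: w => [//|[] w] /=; rewrite !eqseq_cons //=.
    by rewrite inE.
  by rewrite orbF.
Qed.

Lemma wrank_lower v x : x \in lower v -> wrank v = (wrank x).+1.
Proof.
elim: v x => [//|[] v IH] x /=; rewrite inE ?wrank_cons; last by move/eqP->.
case/orP => [/eqP ->|]; first by rewrite wrank_cons.
by rewrite mem_map_cons; case: x => [//|[] x] // /IH ->; rewrite wrank_cons.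
Qed.

Lemma wrank_upper v x : x \in upper v -> wrank x = (wrank v).+1.
Proof. by rewrite mem_upper_lower => /wrank_lower. Qed.

Lemma lower_uniq v : uniq (lower v).
Proof.
elim: v => [//|[] v IH] //=.
by rewrite mem_map_cons /= map_inj_uniq // => x y [].
Qed.

Lemma upper_uniq v : uniq (upper v). Proof. exact: (lower_uniq (true :: v)). Qed.

(** Chains are extended at their upper end, so that counting them iterates [lower_op]. *)
Fixpoint chain_seq (k : nat) (u v : word) : seq (seq word) :=
  if k is k'.+1 then [seq rcons c v | x <- lower v, c <- chain_seq k' u x]
  else if u == v then [:: [::]] else [::].

Lemma mem_chain_seq k u v c :
  reflect [/\ path yfcover u c, last u c = v & size c = k] (c \in chain_seq k u v).
Proof.
elim: k v c => [|k IH] v c /=.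
  apply: (iffP idP) => [|[]].
    by case: eqP => // ->; rewrite inE => /eqP ->.
  by case: c => //= _ -> _; rewrite eqxx.
apply: (iffP allpairsPdep).
  move=> [x [d [xv /IH[pd lx sd] ->]]].
  by rewrite rcons_path last_rcons size_rcons pd lx sd yfcoverE xv.
case; case/lastP: c => // c y; rewrite rcons_path last_rcons size_rcons yfcoverE.
move=> /andP[pc yv] ev [sc]; subst y.
by exists (last u c), c; split=> //; apply/IH.
Qed.

Lemma chain_seq_uniq k u v : uniq (chain_seq k u v).
Proof.
elim: k v => [|k IH] v /=; first by case: ifP.
apply: allpairs_uniq_dep => [|x _|]; [exact: lower_uniq|exact: IH|].
move=> p q /allpairsPdep[x [c [_ /mem_chain_seq[_ xc _] ->]]].
move=> /allpairsPdep[y [d [_ /mem_chain_seq[_ yd _] ->]]] /= /rcons_inj[cd].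
by subst x y; rewrite cd.
Qed.

Lemma wrank_path u c : path yfcover u c -> wrank (last u c) = (wrank u + size c)%N.
Proof.
elim: c u => [|x c IH] u /=; first by rewrite addn0.
by rewrite yfcoverE => /andP[/wrank_lower xu /IH ->]; rewrite xu addnS.
Qed.

Lemma dim_between_chain_seq u v :
  dim_between u v = size (chain_seq (wrank v - wrank u) u v).
Proof.
rewrite /dim_between; set s := chain_seq _ _ _.
have -> : chains u v = [set` [fset c in s]%fset].
  apply/seteqP; split => c /=; rewrite inE.
    by move=> [pc lc]; apply/mem_chain_seq; rewrite -lc wrank_path // addKn.
  by move=> /mem_chain_seq[].
by rewrite set_fsetK card_fseq undup_id // chain_seq_uniq.
Qed.

Section DifferentialPoset.
Variable V : zmodType.
Implicit Types c : word -> V.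

(** On the coefficient functions of formal sums of words, [lower_op] is the up operator U and
    [upper_op] the down operator D. *)
Definition lower_op c (v : word) : V := \sum_(x <- lower v) c x.
Definition upper_op c (v : word) : V := \sum_(x <- upper v) c x.

Lemma lower_op_one c v : lower_op c (false :: v) = c v.
Proof. by rewrite /lower_op big_seq1. Qed.

Lemma lower_op_two c v : lower_op c (true :: v) = upper_op c v.
Proof. by []. Qed.

Lemma upper_opE c v :
  upper_op c v = c (false :: v) + lower_op (fun x => c (true :: x)) v.
Proof. by rewrite /upper_op /lower_op big_cons big_map. Qed.

(* The commutation relation DU - UD = 1 of a 1-differential poset. *)
Lemma upper_lower_op c v :
  upper_op (lower_op c) v = lower_op (upper_op c) v + c v.
Proof. by rewrite upper_opE lower_op_one addrC. Qed.

Lemma lower_op_iter_eq0 k c v : (forall x, (k + wrank x)%N = wrank v -> c x = 0) ->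
  iter k lower_op c v = 0.
Proof.
elim: k v => [|k IH] v hc /=; first exact: hc.
rewrite /lower_op big_seq big1 // => x /wrank_lower xv; apply: IH => y hy.
by apply: hc; rewrite xv -hy.
Qed.

Lemma eq_lower_op c c' v : (forall x, (wrank x).+1 = wrank v -> c x = c' x) ->
  lower_op c v = lower_op c' v.
Proof.
move=> h; rewrite /lower_op !big_seq; apply: eq_bigr => x /wrank_lower xv.
exact/h/esym.
Qed.

Lemma eq_upper_op c c' v : (forall x, wrank x = (wrank v).+1 -> c x = c' x) ->
  upper_op c v = upper_op c' v.
Proof.
move=> h; rewrite /upper_op !big_seq; apply: eq_bigr => x /wrank_upper xv.
exact: h.
Qed.

(** D passes each of the k copies of U at the cost of one commutator. At k = 0 the truncated [k.-1]
    does no harm, since the term is taken 0 times. *)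
Lemma upper_lower_op_iter k c v :
  upper_op (iter k lower_op c) v =
  iter k lower_op (upper_op c) v + iter k.-1 lower_op c v *+ k.
Proof.
elim: k v => [|k IH] v; first by rewrite addr0.
rewrite [iter k.+1 _ c]iterS upper_lower_op (eq_lower_op (fun x _ => IH x)).
rewrite /= {1}/lower_op big_split /= -addrA; congr (_ + _).
rewrite mulrSr; congr (_ + _); rewrite sumrMnl.
by case: k {IH} => [|k] //; rewrite !mulr0n.
Qed.

End DifferentialPoset.

(** * Functionals on the Okada ring *)

Definition okada_gen (b : bool) : okada := mkmalgU (fmu b) 1.

Definition okada_mon (m : {fmonom bool}) : okada := mkmalgU m 1.

Lemma okada_degD n (a : rat) (x y : okada) :
  okada_deg n x -> okada_deg n y -> okada_deg n (a *: x + y).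
Proof.
move=> hx hy m /(fsubsetP (msuppD_le _ _)); rewrite in_fsetU.
by case/orP => [/(fsubsetP (msuppZ_le _ _))/hx|/hy].
Qed.

Lemma okada_deg0 n : okada_deg n 0.
Proof. by move=> m; rewrite msupp0. Qed.

Lemma okada_deg_mon (m : {fmonom bool}) : okada_deg (wrank m) (okada_mon m).
Proof. by move=> k; rewrite msuppU1 inE => /eqP ->. Qed.

Lemma okada_deg1 : okada_deg 0 1.
Proof.
move=> k; rewrite -[X in msupp X]/(okada_mon (fmone bool)) => /okada_deg_mon ->.
by rewrite fmoneE wrank_nil.
Qed.

Lemma okada_degM n k (x y : okada) :
  okada_deg n x -> okada_deg k y -> okada_deg (n + k) (x * y).
Proof.
move=> hx hy m /msuppM_le[k1 [k2 [/hx k1x /hy k2y ->]]].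
by rewrite -[mmul k1 k2]/(fmmul k1 k2) fmmulE wrank_cat k1x k2y.
Qed.

Lemma okada_deg_gen (b : bool) : okada_deg b.+1 (okada_gen b).
Proof. by move=> m /okada_deg_mon ->; rewrite fmuE wrank_cons wrank_nil addn0. Qed.

Lemma okada_degX n : okada_deg n (oX ^+ n).
Proof.
elim: n => [|n IH]; first exact: okada_deg1.
rewrite exprSr -addn1; apply: okada_degM => //.
exact: (@okada_deg_gen false).
Qed.

Lemma okada_monM (m k : {fmonom bool}) : okada_mon m * okada_mon k = okada_mon (fmmul m k).
Proof. by rewrite malgM_def fgmulUU mulr1. Qed.

Lemma okadaE (x : okada) : x = \sum_(m <- msupp x) x@_m *: okada_mon m.
Proof.
rewrite {1}[x]monalgE; apply: eq_bigr => m _; apply/malgP => k.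
by rewrite mcoeffZ !mcoeffU mulrnAr mulr1.
Qed.

Lemma cvg_sum_seq (R : realType) (I : Type) (s : seq I) (F : nat -> I -> R) (l : I -> R) :
  (forall i, F n i @[n --> \oo] --> l i) ->
  \sum_(i <- s) F n i @[n --> \oo] --> \sum_(i <- s) l i.
Proof.
move=> h; elim: s => [|i s IH].
  by rewrite big_nil; under eq_fun do rewrite big_nil; exact: cvg_cst.
by rewrite big_cons; under eq_fun do rewrite big_cons; exact: cvgD.
Qed.

Section LinearOn.
Variable R : realType.
Implicit Types (D : set okada) (f : okada -> R).

Lemma linear_onS D D' f : D `<=` D' -> linear_on D' f -> linear_on D f.
Proof. by move=> sD lf a x y /sD Dx /sD Dy; apply: lf. Qed.

Lemma linear_on0 D f : D 0 -> linear_on D f -> f 0 = 0.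
Proof.
move=> D0 /(_ 1 0 0 D0 D0); rewrite scaler0 addr0 rmorph1 mul1r => /eqP.
by rewrite -subr_eq0 opprD addrA subrr sub0r oppr_eq0 => /eqP.
Qed.

Lemma linear_onD D f x y : linear_on D f -> D x -> D y -> f (x + y) = f x + f y.
Proof. by move=> lf Dx Dy; rewrite -[x in LHS]scale1r lf // rmorph1 mul1r. Qed.

Lemma linear_on_sum D f (I : eqType) (s : seq I) (a : I -> rat) (g : I -> okada) :
  D 0 -> (forall a x y, D x -> D y -> D (a *: x + y)) -> linear_on D f ->
  (forall i, i \in s -> D (g i)) ->
  f (\sum_(i <- s) a i *: g i) = \sum_(i <- s) ratr (a i) * f (g i).
Proof.
move=> D0 DD lf hs.
suff [] : f (\sum_(i <- s) a i *: g i) = \sum_(i <- s) ratr (a i) * f (g i) /\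
          D (\sum_(i <- s) a i *: g i) by [].
elim: s hs => [|i s IH] hs; first by rewrite !big_nil (linear_on0 D0 lf).
have [|e Ds] := IH; first by move=> j js; apply: hs; rewrite inE js orbT.
have Di := hs i (mem_head _ _).
by rewrite !big_cons; split; [rewrite lf // e|exact: DD].
Qed.

Lemma linear_on_seq n f (s : seq word) (b : word -> okada) :
  linear_on (okada_deg n) f -> (forall v, v \in s -> okada_deg n (b v)) ->
  f (\sum_(v <- s) b v) = \sum_(v <- s) f (b v).
Proof.
move=> lf hs; under eq_bigr do rewrite -[b _]scale1r.
rewrite (linear_on_sum _ (okada_deg0 n) (@okada_degD n) lf) //.
by apply: eq_bigr => v _; rewrite rmorph1 mul1r.
Qed.

Lemma linear_on_mulr n (b : bool) f : linear_on (okada_deg (n + b.+1)) f ->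
  linear_on (okada_deg n) (fun x => f (x * okada_gen b)).
Proof.
move=> lf a x y hx hy; rewrite mulrDl -scalerAl lf //.
  by apply: okada_degM => //; exact: okada_deg_gen.
by apply: okada_degM => //; exact: okada_deg_gen.
Qed.

End LinearOn.

(** * Functionals evaluated through transposed multiplication *)

Section Evaluation.
Variables (R : realType) (T : bool -> (word -> R) -> word -> R).
Implicit Types (val : word -> R).

(** Generators are consumed from the right end of a monomial, whence the [rev] in [eval_okada]; each
    one is transferred from the argument to the values by [T]. *)
Fixpoint eval_word val (m : seq bool) : R :=
  if m is b :: m' then eval_word (T b val) m' else val [::].

Definition eval_okada val (x : okada) : R :=
  \sum_(m <- msupp x) ratr x@_m * eval_word val (rev m).

Lemma eval_okadaE val (x : okada) :
  eval_okada val x = mmap (ratr : rat -> R) (fun m : {fmonom bool} => eval_word val (rev m)) x.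
Proof. by []. Qed.

Lemma eval_okada_linear D val : linear_on D (eval_okada val).
Proof.
apply: (@linear_onS _ _ setT) => // a x y _ _; rewrite !eval_okadaE raddfD /=.
congr (_ + _); rewrite mulr_sumr; have [->|a0] := eqVneq a 0.
  rewrite scale0r big1 ?mmap0 //= => m _; by rewrite rmorph0 mul0r.
rewrite /mmap msuppZ (negbTE a0); apply: eq_bigr => m _.
by rewrite mcoeffZ rmorphM /= -mulrA.
Qed.

Lemma eval_okada_mon val (m : {fmonom bool}) :
  eval_okada val (okada_mon m) = eval_word val (rev m).
Proof. by rewrite /eval_okada msuppU1 big_seq_fset1 mcoeffUU rmorph1 mul1r. Qed.

Lemma eval_okada1 val : eval_okada val 1 = val [::].
Proof. by rewrite -[1]/(okada_mon (fmone bool)) eval_okada_mon fmoneE. Qed.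

Lemma eval_okadaM val x b :
  eval_okada val (x * okada_gen b) = eval_okada (T b val) x.
Proof.
rewrite {1}[x]okadaE mulr_suml.
rewrite (eq_bigr (fun m => x@_m *: okada_mon (fmmul m (fmu b)))); last first.
  by move=> m _; rewrite -scalerAl -okada_monM.
rewrite (@linear_on_sum R setT) //; last exact: eval_okada_linear.
by apply: eq_bigr => m _; rewrite eval_okada_mon fmmulE fmuE rev_cat.
Qed.

Lemma eval_okadaX val x : eval_okada val (x * oX) = eval_okada (T false val) x.
Proof. exact: eval_okadaM. Qed.

Lemma eval_okadaY val x : eval_okada val (x * oY) = eval_okada (T true val) x.
Proof. exact: eval_okadaM. Qed.

Lemma eval_okadaD val x y : eval_okada val (x + y) = eval_okada val x + eval_okada val y.
Proof. exact: (linear_onD (@eval_okada_linear setT val)). Qed.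

Lemma eval_okadaZ val a x : eval_okada val (a *: x) = ratr a * eval_okada val x.
Proof.
rewrite -[a *: x]addr0 (@eval_okada_linear setT) //.
rewrite (linear_on0 _ (@eval_okada_linear setT val)) //.
by rewrite addr0.
Qed.

(* [b] spans the Okada ring and is linearly independent, and [T] is the
   transpose of right multiplication by the generators in the basis [b]. *)
Record right_basis (b : word -> okada) : Prop := RightBasis {
  rb_one : b [::] = 1;
  rb_deg : forall v, okada_deg (wrank v) (b v);
  rb_linear : forall (c : bool) a (f g : word -> R) v,
    T c (fun v => a * f v + g v) v = a * T c f v + T c g v;
  rb_local : forall (c : bool) (f g : word -> R) v,
    (forall x, wrank x = (wrank v + c.+1)%N -> f x = g x) -> T c f v = T c g v;
  rb_mul : forall (c : bool) (f : okada -> R) v, linear_on (okada_deg (wrank v + c.+1)) f ->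
    f (b v * okada_gen c) = T c (f \o b) v;
  rb_eval : forall val v, eval_okada val (b v) = val v }.

Section Basis.
Variables (b : word -> okada) (hb : right_basis b).

Lemma eq_eval_word val val' m : (forall v, wrank v = wrank m -> val v = val' v) ->
  eval_word val m = eval_word val' m.
Proof.
elim: m val val' => [|c m IH] val val' h /=; first by apply: h.
apply: IH => v vm; apply: (rb_local hb) => x hx; apply: h.
by rewrite wrank_cons hx vm addnC.
Qed.

Lemma wrank_rev v : wrank (rev v) = wrank v.
Proof. by rewrite /wrank big_rev. Qed.

Lemma eq_eval_okada n val val' x : okada_deg n x ->
  (forall v, wrank v = n -> val v = val' v) -> eval_okada val x = eval_okada val' x.
Proof.
move=> hx h; rewrite /eval_okada !big_seq; apply: eq_bigr => m /hx mn.
by congr (_ * _); apply: eq_eval_word => v; rewrite wrank_rev mn => /h.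
Qed.

Lemma eval_word_linear a val val' m :
  eval_word (fun v => a * val v + val' v) m = a * eval_word val m + eval_word val' m.
Proof.
elim: m val val' => [//|c m IH] val val' /=.
rewrite -IH; apply: eq_eval_word => v _; exact: (rb_linear hb).
Qed.

Lemma eval_okada_val_linear a val val' x :
  eval_okada (fun v => a * val v + val' v) x =
  a * eval_okada val x + eval_okada val' x.
Proof.
rewrite /eval_okada mulr_sumr -big_split; apply: eq_bigr => m _ /=.
by rewrite eval_word_linear mulrDr mulrCA.
Qed.

Lemma eval_okada_val0 x : eval_okada (fun=> 0) x = 0.
Proof.
have := eval_okada_val_linear 1 (fun=> 0) (fun=> 0) x.
under eq_fun do rewrite mulr0 addr0.
by rewrite mul1r => /eqP; rewrite -subr_eq0 opprD addrA subrr sub0r oppr_eq0 => /eqP.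
Qed.

Lemma eval_okada_valZ a val x :
  eval_okada (fun v => a * val v) x = a * eval_okada val x.
Proof.
have := eval_okada_val_linear a val (fun=> 0) x.
by rewrite eval_okada_val0 addr0; under eq_fun do rewrite addr0.
Qed.

Lemma eval_okada_valD val val' x :
  eval_okada (fun v => val v + val' v) x = eval_okada val x + eval_okada val' x.
Proof.
have := eval_okada_val_linear 1 val val' x.
by rewrite mul1r => <-; congr eval_okada; apply/funext => v; rewrite mul1r.
Qed.

Lemma eval_okada_val_sum (I : Type) (s : seq I) (F : I -> word -> R) x :
  eval_okada (fun v => \sum_(i <- s) F i v) x = \sum_(i <- s) eval_okada (F i) x.
Proof.
elim: s => [|i s IH].
  by rewrite big_nil -[RHS](eval_okada_val0 x); under eq_fun do rewrite big_nil.
by rewrite big_cons -IH -eval_okada_valD; under eq_fun do rewrite big_cons.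
Qed.

Lemma linear_on_mon n (f : okada -> R) (m : {fmonom bool}) : linear_on (okada_deg n) f ->
  wrank m = n -> f (okada_mon m) = eval_word (f \o b) (rev m).
Proof.
rewrite -[m in okada_mon m]fmK; move: (fmonom_val m) => {}m.
elim/last_ind: m n f => [|m c IH] n f lf mn.
  by rewrite -fmoneE /= (rb_one hb).
have -> : okada_mon (FMonom (rcons m c)) = okada_mon (FMonom m) * okada_gen c.
  by rewrite /okada_gen okada_monM fmmulE fmuE cats1.
rewrite -cats1 wrank_cat wrank_cons wrank_nil addn0 in mn.
rewrite rev_rcons /= -mn in lf *.
rewrite (IH _ _ (linear_on_mulr lf)) //.
apply: eq_eval_word => v; rewrite wrank_rev => vm; rewrite /= (rb_mul hb) //.
by rewrite vm.
Qed.

Lemma linear_on_evalT (f : okada -> R) x : linear_on setT f ->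
  f x = eval_okada (f \o b) x.
Proof.
move=> lf; rewrite {1}[x]okadaE (linear_on_sum _ _ _ lf) //.
apply: eq_bigr => m _; congr (_ * _); apply: linear_on_mon (erefl).
exact: linear_onS lf.
Qed.

Lemma linear_on_eval_deg n (f : okada -> R) x : linear_on (okada_deg n) f ->
  okada_deg n x -> f x = eval_okada (f \o b) x.
Proof.
move=> lf hx; have hm m : m \in msupp x -> okada_deg n (okada_mon m).
  by move=> /hx <-; exact: okada_deg_mon.
rewrite {1}[x]okadaE (linear_on_sum _ (okada_deg0 n) (@okada_degD n) lf) //.
rewrite /eval_okada !big_seq; apply: eq_bigr => m /hx mn; congr (_ * _).
exact: linear_on_mon mn.
Qed.

Lemma functional_spec D I val :
  linear_on D (functional D I b val) /\
  forall v, I v -> functional D I b val (b v) = val v.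
Proof.
apply: (@getPex _ [set f | linear_on D f /\ forall v, I v -> f (b v) = val v]).
(* The choice made by [get] is meaningful only if some functional takes the prescribed values;
   evaluation through [T] is one. *)
exists (eval_okada val); split=> [|v _]; first exact: eval_okada_linear.
exact: (rb_eval hb).
Qed.

Lemma functionalT val : functional setT setT b val = eval_okada val.
Proof.
have [lf fb] := functional_spec setT setT val.
apply/funext => x; rewrite linear_on_evalT //; congr eval_okada.
by apply/funext => v /=; rewrite fb.
Qed.

Lemma functional_deg n val x : okada_deg n x ->
  functional (okada_deg n) (YF n) b val x = eval_okada val x.
Proof.
have [lf fb] := functional_spec (okada_deg n) (YF n) val => hx.
by rewrite (linear_on_eval_deg lf) //; apply: eq_eval_okada hx _ => v /fb.
Qed.

End Basis.

(** A fixed element has finitely many monomials and each [T c] respects pointwise limits, so limits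
    need only be taken on the basis. *)
Lemma eval_okada_cvg (vals : nat -> word -> R) val x :
  (forall c (vs : nat -> word -> R) vl, (forall v, vs n v @[n --> \oo] --> vl v) ->
    forall v, T c (vs n) v @[n --> \oo] --> T c vl v) ->
  (forall v, vals n v @[n --> \oo] --> val v) ->
  eval_okada (vals n) x @[n --> \oo] --> eval_okada val x.
Proof.
move=> hT hv; apply: cvg_sum_seq => m; apply: cvgMr.
elim: (rev m) vals val hv => [|c m' IH] vs vl hv /=; first exact: hv.
by apply: IH => v; apply: hT.
Qed.
End Evaluation.

(** * The bases s and p *)

Section ColumnOrderedDeterminant.
Variable S : nzRingType.

Definition col_det (n : nat) (A : 'M[S]_n) : S :=
  \sum_(s : 'S_n) (-1) ^+ s * \prod_(j < n) A (s j) j.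

Lemma prod_ring_eq0 (I : eqType) (s : seq I) (F : I -> S) i :
  i \in s -> F i = 0 -> \prod_(j <- s) F j = 0.
Proof.
elim: s => // j s IH; rewrite inE big_cons => /orP[/eqP <- ->|/IH h /h ->].
  exact: mul0r.
exact: mulr0.
Qed.

Lemma col_det_row0 n (A : 'M[S]_n) i : (forall j, A i j = 0) -> col_det A = 0.
Proof.
move=> Ai; rewrite /col_det big1 // => s _.
rewrite (@prod_ring_eq0 _ _ _ ((s^-1)%g i)) ?mulr0 ?mem_index_enum //.
by rewrite permKV.
Qed.

(** The factor from the last column stands rightmost in every product, so expansion along that
    column survives noncommutativity. *)
Lemma col_det_last n (A : 'M[S]_n.+1) :
  col_det A =
  \sum_(i < n.+1) (-1) ^+ (n + i) * col_det (row' i (col' ord_max A)) * A i ord_max.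
Proof.
rewrite {1}/col_det (partition_big (fun s : 'S_n.+1 => s ord_max) xpredT) //=.
apply: eq_bigr => i _; rewrite mulr_sumr mulr_suml.
rewrite (reindex (lift_perm ord_max i)) /=; last first.
  pose ulsf (s : 'S_n.+1) k := odflt k (unlift (s ord_max) (s (lift ord_max k))).
  have ulsfK (s : 'S_n.+1) k : lift (s ord_max) (ulsf s k) = s (lift ord_max k).
    rewrite /ulsf; have:= neq_lift ord_max k.
    by rewrite -(can_eq (permK s)) => /unlift_some[] ? ? ->.
  have inj_ulsf s : injective (ulsf s).
    by move=> k l /(congr1 (lift (s ord_max))); rewrite !ulsfK => /perm_inj/lift_inj.
  exists (fun s => perm (inj_ulsf s)) => [s _|s].
    apply/permP => k; rewrite permE.
    by rewrite /ulsf lift_perm_lift lift_perm_id liftK.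
  rewrite inE => /eqP si; apply/permP => k; have [j ->|->] := unliftP ord_max k.
    by rewrite lift_perm_lift permE -si ulsfK.
  by rewrite lift_perm_id.
apply: eq_big => [s|s _]; first by rewrite lift_perm_id eqxx.
rewrite big_ord_recr /= lift_perm_id mulrA odd_lift_perm !signr_addb.
rewrite !signr_odd exprD -!mulrA; congr (_ * (_ * (_ * (_ * _)))).
congr (_ * _); apply: eq_bigr => k _; rewrite !mxE.
have -> : widen_ord (leqnSn n) k = lift ord_max k by exact/val_inj/esym/lift_max.
by rewrite lift_perm_lift.
Qed.

Definition entries_det (a : nat -> nat -> S) (n : nat) : S :=
  col_det (\matrix_(i < n, j < n) a i j).

Lemma entries_det0 a : entries_det a 0 = 1.
Proof.
rewrite /entries_det /col_det (big_pred1 1%g) => [|s]; last first.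
  by apply/esym/eqP/permP => -[].
by rewrite big_ord0 odd_perm1 mulr1.
Qed.

Lemma entries_det1 a : entries_det a 1 = a 0%N 0%N.
Proof.
rewrite /entries_det col_det_last big_ord1 /= addn0 mul1r mxE.
rewrite -[RHS]mul1r; congr (_ * _).
rewrite -(entries_det0 a) /entries_det; congr col_det.
by apply/matrixP => -[].
Qed.

(** Expand along the last column, then expand the minor of the superdiagonal entry along its own
    last column; every other second minor keeps the last row, which vanishes there. The subdiagonal
    entry precedes the superdiagonal one because its column comes first. *)
Lemma entries_det_tridiagonal a n :
  (forall i, (i < n)%N -> a i n.+1 = 0) -> (forall j, (j < n)%N -> a n.+1 j = 0) ->
  entries_det a n.+2 = entries_det a n.+1 * a n.+1 n.+1
    - entries_det a n * a n.+1 n * a n n.+1.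
Proof.
move=> hr hc; rewrite {1}/entries_det col_det_last big_ord_recr /= big_ord_recr /=.
rewrite big1 ?add0r => [|i _]; last by rewrite mxE /= hr // mulr0.
have sq k : (-1) ^+ (k + k) = 1 :> S.
  by rewrite addnn -mul2n exprM sqrrN expr1n expr1n.
rewrite addrC !mxE /=; congr (_ + _).
  rewrite sq mul1r; congr (col_det _ * _).
  by apply/matrixP => i j; rewrite !mxE !lift_max.
rewrite addSn exprS sq mulr1 mulN1r mulNr.
congr (- (_ * _)); set B := row' _ _.
rewrite col_det_last big_ord_recr /= big1 ?add0r => [|i _].
  rewrite sq mul1r; congr (col_det _ * _).
    apply/matrixP => i j; rewrite !mxE !lift_max; congr a => /=.
    have ni : (n <= i)%N = false by rewrite leqNgt ltn_ord.
    by rewrite /bump ni add0n ni.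
  by rewrite !mxE lift_max /= /bump leqnn.
rewrite (_ : col_det _ = 0) ?mulr0 ?mul0r // {}/B.
case: n hr hc i => [|n] hr hc [i hi]; first by [].
apply: (col_det_row0 (i := ord_max)) => j; rewrite !mxE !lift_max /=.
by rewrite (_ : bump _ _ = n.+2) ?hc // /bump; lia.
Qed.

End ColumnOrderedDeterminant.

Lemma okada_PE n : okada_P n = entries_det Pentry n. Proof. by []. Qed.
Lemma okada_QE n : okada_Q n = entries_det Qentry n.+1. Proof. by []. Qed.

Lemma okada_P0 : okada_P 0 = 1. Proof. exact: entries_det0. Qed.
Lemma okada_P1 : okada_P 1 = oX. Proof. exact: entries_det1. Qed.
Lemma okada_Q0 : okada_Q 0 = oY. Proof. exact: entries_det1. Qed.

Lemma Pentry_diag n : Pentry n n = oX.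
Proof. by rewrite /Pentry eqxx. Qed.

Lemma Pentry_up n : Pentry n n.+1 = oY.
Proof. by rewrite /Pentry eqxx (ltn_eqF (ltnSn n)). Qed.

Lemma Pentry_down n : Pentry n.+1 n = 1.
Proof. by rewrite /Pentry eqxx (gtn_eqF (ltnSn n)) (ltn_eqF (leqnSn n.+1)). Qed.

Lemma Pentry_far i j : (i.+1 < j)%N || (j.+1 < i)%N -> Pentry i j = 0.
Proof.
by move=> h; rewrite /Pentry; do !case: eqP => //; lia.
Qed.

Lemma okada_PS n : okada_P n.+2 = okada_P n.+1 * oX - okada_P n * oY.
Proof.
rewrite !okada_PE entries_det_tridiagonal => [|i hi|j hj]; last 2 first.
- by rewrite Pentry_far // ltnS hi.
- by rewrite Pentry_far // ltnS hj orbT.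
by rewrite Pentry_diag Pentry_up Pentry_down mulr1.
Qed.

(** The subdiagonal entry in the second row is X rather than 1, so this case falls outside the
    three-term recurrence. *)
Lemma okada_Q1 : okada_Q 1 = oY * oX - oX * oY.
Proof.
rewrite okada_QE entries_det_tridiagonal => [|i|j]; [|by rewrite ltn0..].
rewrite entries_det1 entries_det0.
by rewrite -[Qentry 0 0]/oY -[Qentry 1 1]/oX -[Qentry 1 0]/oX -[Qentry 0 1]/oY mul1r.
Qed.

Lemma okada_QS n : okada_Q n.+2 = okada_Q n.+1 * oX - okada_Q n * oY.
Proof.
rewrite !okada_QE entries_det_tridiagonal => [|i hi|j hj]; last 2 first.
- case: i hi => [|[|i]] hi; [by []|by case: n hi|].
  by rewrite -[LHS]/(Pentry i.+2 n.+2) Pentry_far // ltnS hi.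
- by rewrite -[LHS]/(Pentry n.+2 j) Pentry_far // ltnS hj orbT.
rewrite -[Qentry n.+2 n.+2]/(Pentry n.+2 n.+2) -[Qentry n.+2 n.+1]/(Pentry n.+2 n.+1).
rewrite Pentry_diag Pentry_down mulr1; case: n => [//|n].
by rewrite -[Qentry n.+2 n.+3]/(Pentry n.+2 n.+3) Pentry_up.
Qed.

Lemma lblocks_cat k u : lblocks (nseq k false ++ true :: u) = k :: lblocks u.
Proof. by elim: k => //= k ->. Qed.

Lemma lblocks_nseq k : lblocks (nseq k false) = [:: k].
Proof. by elim: k => //= k ->. Qed.

Lemma size_lblocks v : size (lblocks v) = (ntwos v).+1.
Proof.
elim: v => //= -[] v IH /=; first by rewrite IH.
by rewrite size_behead IH.
Qed.

(** The leading block k_t, which is the exponent of the trailing power of X in [okada_p v]. *)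
Definition ones (v : word) : nat := head 0%N (lblocks v).

Lemma ones_one v : ones (false :: v) = (ones v).+1. Proof. by []. Qed.

Lemma block_ntwos v : block v (ntwos v) = ones v.
Proof.
rewrite /block nth_rev ?size_lblocks // subnn /ones.
by case: (lblocks v).
Qed.

Lemma block_two v i : (i <= ntwos v)%N -> block (true :: v) i = block v i.
Proof.
by move=> hi; rewrite /block /= rev_cons nth_rcons size_rev size_lblocks ltnS hi.
Qed.

Lemma block_one v i : (i < ntwos v)%N -> block (false :: v) i = block v i.
Proof.
move=> hi; rewrite /block /=; case: (lblocks v) (size_lblocks v) => [//|k l] [sl] /=.
by rewrite !rev_cons !nth_rcons size_rev sl hi.
Qed.

Lemma ones_spec v :
  {k | v = nseq k false} + {ku : nat * word | v = nseq ku.1 false ++ true :: ku.2}.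
Proof.
elim: v => [|[] v IH]; first by left; exists 0%N.
  by right; exists (0%N, v).
case: IH => [[k ->]|[[k u] /= ->]]; first by left; exists k.+1.
by right; exists (k.+1, u).
Qed.

(* Over an abstract ring, because conversion on the concrete monoid algebra is
   prohibitively slow. *)
Section WordProducts.
Variables (S : nzRingType) (X Y : S) (P Q : nat -> S).
Hypotheses (P0 : P 0%N = 1) (P1 : P 1%N = X) (Q0 : Q 0%N = Y).
Hypothesis Q1 : Q 1%N = Y * X - X * Y.
Hypothesis PS : forall n, P n.+2 = P n.+1 * X - P n * Y.
Hypothesis QS : forall n, Q n.+2 = Q n.+1 * X - Q n * Y.

Definition word_s (v : word) : S :=
  P (block v 0) * \prod_(1 <= i < (ntwos v).+1) Q (block v i).

Definition word_p (v : word) : S :=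
  (\prod_(0 <= i < ntwos v)
     (X ^+ (block v i).+2 - (block v i).+2%:R * X ^+ block v i * Y))
  * X ^+ block v (ntwos v).

Lemma word_s_nil : word_s [::] = 1.
Proof. by rewrite /word_s big_geq // mulr1; exact: P0. Qed.

Lemma word_s_nseq k : word_s (nseq k false) = P k.
Proof.
rewrite /word_s /ntwos count_nseq /= mul0n big_geq // mulr1.
by rewrite /block lblocks_nseq.
Qed.

Lemma word_s_cat k u : word_s (nseq k false ++ true :: u) = word_s u * Q k.
Proof.
rewrite /word_s /ntwos count_cat count_nseq /= mul0n add0n -/(ntwos u).
rewrite big_nat_recr //= mulrA /block lblocks_cat rev_cons.
rewrite !nth_rcons size_rev size_lblocks /= ltnn eqxx; congr (_ * _ * _).
rewrite !big_nat; apply: eq_bigr => i /andP[_ hi].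
by rewrite nth_rcons size_rev size_lblocks hi.
Qed.

Lemma word_s_two v : word_s (true :: v) = word_s v * Y.
Proof. by rewrite (word_s_cat 0) Q0. Qed.

(** If [v] starts with 1 this is the three-term recurrence of P or Q. If v = 2v', the term -XY of
    Q_1 produces s_{v'} X, which by induction is the sum of s over the covers of v', that is, over
    [lower v]. *)
Lemma word_s_one v :
  word_s (false :: v) = word_s v * X - \sum_(u <- lower v) word_s u * Y.
Proof.
elim: v => [|[] v IH].
- by rewrite big_nil subr0 word_s_nil mul1r (word_s_nseq 1) P1.
- rewrite (word_s_cat 1) Q1 mulrBr !mulrA -word_s_two; congr (_ - _).
  rewrite -mulr_suml; congr (_ * _); rewrite -[lower _]/(upper v) big_cons IH big_map.
  by under [in RHS]eq_bigr do rewrite word_s_two; rewrite subrK.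
- rewrite big_seq1; have [[k ->]|[[k u] ->]] := ones_spec v.
    by rewrite (word_s_nseq k.+2) (word_s_nseq k.+1) word_s_nseq PS.
  rewrite (word_s_cat k.+2) (word_s_cat k.+1) word_s_cat QS.
  by rewrite mulrBr !mulrA.
Qed.

Lemma word_sX v : word_s v * X = \sum_(x <- upper v) word_s x.
Proof.
rewrite big_cons big_map word_s_one.
by under [X in _ + X]eq_bigr do rewrite word_s_two; rewrite subrK.
Qed.

Lemma word_p_nil : word_p [::] = 1.
Proof. by rewrite /word_p big_geq // mul1r. Qed.

Lemma word_p_one v : word_p (false :: v) = word_p v * X.
Proof.
rewrite /word_p !block_ntwos ones_one exprSr mulrA; congr (_ * _ * _).
rewrite -[ntwos (_ :: _)]/(ntwos v) !big_nat.
by apply: eq_bigr => i /andP[_ hi]; rewrite block_one.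
Qed.

Lemma word_p_two v :
  word_p (true :: v) = word_p v * X * X - (word_p v * Y) *+ (ones v).+2.
Proof.
rewrite /word_p !block_ntwos -[ntwos (_ :: _)]/(ntwos v).+1 big_nat_recr //=.
rewrite block_two // block_ntwos /ones expr0 mulr1 -/(ones v).
rewrite (eq_big_nat _ _ (F2 := fun i => X ^+ (block v i).+2 -
  (block v i).+2%:R * X ^+ block v i * Y)); last first.
  by move=> i /andP[_ hi]; rewrite block_two // ltnW.
rewrite mulrBr; congr (_ - _); first by rewrite !exprSr !mulrA.
by rewrite -!mulrA mulr_natl !mulrnAr !mulrA.
Qed.

End WordProducts.

Lemma okada_s_nil : okada_s [::] = 1. Proof. exact: word_s_nil okada_P0. Qed.

Lemma okada_s_two v : okada_s (true :: v) = okada_s v * oY.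
Proof. exact: word_s_two okada_Q0 v. Qed.

Lemma okada_s_one v :
  okada_s (false :: v) = okada_s v * oX - \sum_(u <- lower v) okada_s u * oY.
Proof. exact: (word_s_one okada_P0 okada_P1 okada_Q0 okada_Q1 okada_PS okada_QS). Qed.

Lemma okada_sX v : okada_s v * oX = \sum_(x <- upper v) okada_s x.
Proof. exact: (word_sX okada_P0 okada_P1 okada_Q0 okada_Q1 okada_PS okada_QS). Qed.

Lemma okada_p_nil : okada_p [::] = 1. Proof. exact: word_p_nil. Qed.

Lemma okada_p_one v : okada_p (false :: v) = okada_p v * oX.
Proof. exact: word_p_one. Qed.

Lemma okada_p_two v :
  okada_p (true :: v) = - (ones v).+2%:R *: (okada_p v * oY)
    + okada_p [:: false, false & v].
Proof. by rewrite !okada_p_one scaleNr scaler_nat addrC; exact: word_p_two. Qed.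

Lemma okada_deg_s v : okada_deg (wrank v) (okada_s v).
Proof.
have [n] := ubnP (wrank v); elim: n v => // n IH [|[] v] hn.
- by rewrite okada_s_nil wrank_nil; exact: okada_deg1.
- rewrite wrank_cons ltnS in hn *; rewrite okada_s_two addnC.
  apply: okada_degM (@okada_deg_gen true); apply: IH; exact: leq_trans hn.
- rewrite wrank_cons ltnS in hn *; rewrite okada_s_one addnC addrC -scaleN1r.
  apply: okada_degD; last first.
    by apply: okada_degM (@okada_deg_gen false); apply: IH.
  rewrite big_seq; elim/big_ind: _ => [|x y hx hy|u /wrank_lower uv].
  + exact: okada_deg0.
  + by rewrite -[x]scale1r; apply: okada_degD.
  + rewrite uv addn1 -addn2; apply: okada_degM (@okada_deg_gen true).
    by apply: IH; move: hn; rewrite uv; lia.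
Qed.

Lemma okada_deg_p v : okada_deg (wrank v) (okada_p v).
Proof.
elim: v => [|[] v IH]; first by rewrite okada_p_nil wrank_nil; exact: okada_deg1.
  rewrite okada_p_two wrank_cons addnC; apply: okada_degD.
    exact: okada_degM (@okada_deg_gen true).
  rewrite -[(_ + _)%N]/(wrank v + (1 + 1))%N addnA.
  rewrite !okada_p_one.
  by do 2![apply: okada_degM (@okada_deg_gen false)].
rewrite okada_p_one wrank_cons addnC; exact: okada_degM (@okada_deg_gen false).
Qed.

Section Bases.
Variable R : realType.
Implicit Types (f g val : word -> R).

Definition s_op (c : bool) f (v : word) : R :=
  if c then f (true :: v) else upper_op f v.

(** The case of Y comes from solving [okada_p_two] for [okada_p v * oY]. *)
Definition p_op (c : bool) f (v : word) : R :=
  if c then (f [:: false, false & v] - f (true :: v)) / (ones v).+2%:R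
  else f (false :: v).

Lemma right_basis_s : right_basis s_op okada_s.
Proof.
split=> [||c a f g v|c f g v h|c f v lf|val v].
- exact: okada_s_nil.
- exact: okada_deg_s.
- by case: c => //=; rewrite /upper_op mulr_sumr -big_split.
- case: c h => /= h; first by apply: h; rewrite wrank_cons addnC.
  by apply: eq_upper_op => x hx; apply: h; rewrite addn1.
- case: c lf => lf /=; first by rewrite okada_s_two.
  rewrite -[okada_gen false]/oX okada_sX addn1 in lf *.
  by apply: linear_on_seq lf _ => x /wrank_upper <-; exact: okada_deg_s.
(* For a leading 1, the values at words 2u that [upper_op] introduces cancel against the subtracted
   [okada_s u * oY]. *)
- have [n] := ubnP (wrank v); elim: n v val => // n IH [|[] v] val.
  + by rewrite okada_s_nil eval_okada1.
  + rewrite wrank_cons ltnS => hn; rewrite okada_s_two.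
    by rewrite eval_okadaY IH //; apply: leq_trans hn.
  + rewrite wrank_cons ltnS => hn; rewrite okada_s_one -scaleN1r eval_okadaD eval_okadaZ.
    rewrite eval_okadaX IH // rmorphN rmorph1 mulN1r.
    under eq_bigr do rewrite -[_ * _]scale1r.
    rewrite (@linear_on_sum R setT) //; last exact: eval_okada_linear.
    rewrite /= upper_opE /lower_op big_seq [X in _ - X]big_seq.
    rewrite [X in _ - X](eq_bigr (fun x => val (true :: x))) ?addrK // => u uv.
    rewrite rmorph1 mul1r eval_okadaY IH //.
    by move: hn; rewrite (wrank_lower uv); lia.
Qed.

Lemma right_basis_p : right_basis p_op okada_p.
Proof.
split=> [||c a f g v|c f g v h|c f v lf|val v].
- exact: okada_p_nil.
- exact: okada_deg_p.
- by case: c; rewrite /p_op //; ring.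
- case: c h => /= h; last by apply: h; rewrite wrank_cons addnC.
  by rewrite !h // !wrank_cons; lia.
- case: c lf => lf; last by rewrite /= okada_p_one.
  have ne0 : (ones v).+2%:R != 0 :> R by rewrite pnatr_eq0.
  apply: (mulIf ne0); rewrite /p_op (divfK ne0) /comp okada_p_two.
  have d1 : okada_deg (wrank v + 2) (okada_p v * oY).
    exact: okada_degM (@okada_deg_p v) (@okada_deg_gen true).
  have d2 : okada_deg (wrank v + 2) (okada_p [:: false, false & v]).
    by rewrite addnC; have := @okada_deg_p [:: false, false & v]; rewrite !wrank_cons.
  rewrite -[okada_gen true]/oY (lf _ _ _ d1 d2) rmorphN rmorph_nat.
  have aux (k A B : R) : A * k = B - (- k * A + B) by ring.
  exact: aux.
- elim: v val => [|[] v IH] val.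
  + by rewrite okada_p_nil eval_okada1.
  + rewrite okada_p_two eval_okadaD eval_okadaZ !okada_p_one.
    rewrite [X in _ * X + _]eval_okadaY [X in _ + X]eval_okadaX [X in _ + X]eval_okadaX.
    by rewrite !IH /p_op rmorphN rmorph_nat mulNr mulrCA mulfV ?pnatr_eq0 // mulr1; ring.
  + by rewrite okada_p_one eval_okadaX IH.
Qed.

Lemma p_op_cvg (c : bool) (vs : nat -> word -> R) vl :
  (forall v, vs n v @[n --> \oo] --> vl v) ->
    forall v, p_op c (vs n) v @[n --> \oo] --> p_op c vl v.
Proof.
by case: c => h v /=; [apply: cvgMl; apply: cvgB; exact: h|exact: h].
Qed.

End Bases.

(** * Values of the functionals on the basis p *)

Lemma ones_le_wrank v : (ones v <= wrank v)%N.
Proof.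
by elim: v => [|[] v IH]; rewrite ?wrank_cons //; rewrite ones_one ltnS.
Qed.

Lemma wrank_nseq_cat j u : wrank (nseq j false ++ u) = (j + wrank u)%N.
Proof. by elim: j => //= j IH; rewrite wrank_cons IH. Qed.

Lemma finite_YF n : finite_set (YF n).
Proof.
suff [] : finite_set (YF n) /\ finite_set (YF n.+1) by [].
elim: n => [|n [IH0 IH1]].
  split; apply: (@sub_finite_set _ _ [set` [:: [::]; [:: false]]]) => // v /=.
  - by move=> /wrank_eq0 ->; rewrite !inE.
  - case: v => [|[] v]; rewrite /YF /= ?wrank_nil ?wrank_cons // => -[] /wrank_eq0 ->.
    by rewrite !inE.
split=> //; apply: (@sub_finite_set _ _
    ((cons false) @` YF n.+1 `|` (cons true) @` YF n)).
  move=> [|[] v]; rewrite /YF /= ?wrank_nil ?wrank_cons // => -[] h; [right|left];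
    by exists v.
by rewrite finite_setU; split; exact: finite_image.
Qed.

Lemma mem_YF n v : (v \in fset_set (YF n)) = (wrank v == n).
Proof.
rewrite in_fset_set; last exact: finite_YF.
by apply/idP/eqP => [/set_mem|/mem_set].
Qed.

Section AlgebraicIdentities.
Variable R : realType.
Implicit Types (f phi val : word -> R) (u v w : word) (g : nat -> R).
Local Notation evs := (eval_okada (@s_op R)).
Local Notation evp := (eval_okada (@p_op R)).

Definition delta w : word -> R := fun v => (v == w)%:R.

Lemma sum_delta (s : seq word) w : uniq s -> \sum_(x <- s) delta w x = (w \in s)%:R.
Proof.
rewrite /delta; elim: s => [_|x s IH /= /andP[xs us]]; first by rewrite big_nil.
rewrite big_cons IH // inE eq_sym; case: eqP => [wx|_]; last by rewrite add0r.
by rewrite wx (negbTE xs) addr0.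
Qed.

Lemma upper_delta_one v : upper_op (delta (false :: v)) = delta v.
Proof.
by apply/funext => x; rewrite /upper_op sum_delta ?upper_uniq // mem_upper eq_sym.
Qed.

Lemma upper_delta_two v : upper_op (delta (true :: v)) = lower_op (delta v).
Proof.
apply/funext => x; rewrite /upper_op /lower_op !sum_delta ?upper_uniq ?lower_uniq //.
by rewrite mem_upper.
Qed.

Lemma upper_delta_nil v : upper_op (delta [::]) v = 0.
Proof. by rewrite /upper_op sum_delta ?upper_uniq // mem_upper. Qed.

Lemma chain_seq_lower_op k u v :
  (size (chain_seq k u v))%:R = iter k (@lower_op R) (delta u) v.
Proof.
elim: k v => [|k IH] v /=; first by rewrite /delta eq_sym; case: eqP.
rewrite size_allpairs_dep sumnE big_map natr_sum.
by apply: eq_bigr => x _; exact: IH.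
Qed.

Lemma dim_between_lower_op u v :
  (dim_between u v)%:R = iter (wrank v - wrank u) (@lower_op R) (delta u) v.
Proof. by rewrite dim_between_chain_seq chain_seq_lower_op. Qed.

Lemma dim_lower_op v : (Defs.dim v)%:R = iter (wrank v) (@lower_op R) (delta [::]) v.
Proof. by rewrite /Defs.dim dim_between_lower_op wrank_nil subn0. Qed.

Lemma dim_nil : (Defs.dim [::])%:R = 1 :> R.
Proof. by rewrite dim_lower_op wrank_nil /= /delta eqxx. Qed.

Lemma dim_one v : (Defs.dim (false :: v))%:R = (Defs.dim v)%:R :> R.
Proof. by rewrite !dim_lower_op wrank_cons add1n iterS lower_op_one. Qed.

Lemma dim_two_upper v :
  (Defs.dim (true :: v))%:R = upper_op (fun x => (Defs.dim x)%:R : R) v.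
Proof.
rewrite dim_lower_op wrank_cons add2n iterS lower_op_two.
by apply: eq_upper_op => x xv; rewrite dim_lower_op xv.
Qed.

(** D passes through the |v| + 1 copies of U and kills the empty word, so only the |v| + 1
    commutator terms remain. *)
Lemma dim_two v : (Defs.dim (true :: v))%:R = (wrank v).+1%:R * (Defs.dim v)%:R :> R.
Proof.
rewrite dim_lower_op wrank_cons add2n iterS lower_op_two upper_lower_op_iter.
rewrite lower_op_iter_eq0 ?add0r => [|x _]; last exact: upper_delta_nil.
by rewrite dim_lower_op mulr_natl.
Qed.

Lemma dim_gt0 v : 0 < (Defs.dim v)%:R :> R.
Proof.
elim: v => [|[] v IH]; first by rewrite dim_nil.
  by rewrite dim_two mulr_gt0.
by rewrite dim_one.
Qed.

(* Sealed, so that unification never unfolds the monoid algebra. *)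
Fact pval_key : {F : (word -> R) -> word -> R | forall f u, F f u = evs f (okada_p u)}.
Proof. by exists (fun f u => evs f (okada_p u)). Qed.

Definition pval : (word -> R) -> word -> R := sval pval_key.

Lemma pvalE f u : pval f u = evs f (okada_p u).
Proof. exact: (svalP pval_key). Qed.

Lemma pval_nil f : pval f [::] = f [::].
Proof. by rewrite pvalE okada_p_nil eval_okada1. Qed.

Lemma pval_one f u : pval f (false :: u) = pval (upper_op f) u.
Proof. by rewrite !pvalE okada_p_one eval_okadaX. Qed.

Lemma pval_two f u : pval f (true :: u) =
  pval f [:: false, false & u] - (ones u).+2%:R * pval (fun v => f (true :: v)) u.
Proof.
rewrite [LHS]pvalE okada_p_two eval_okadaD eval_okadaZ [X in _ * X + _]eval_okadaY.
by rewrite -[X in _ + X]pvalE -[X in _ * X + _]pvalE rmorphN rmorph_nat mulNr addrC.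
Qed.

Lemma pval0 u : pval (fun=> 0) u = 0.
Proof. by rewrite pvalE (eval_okada_val0 (right_basis_s R)). Qed.

Lemma pvalZ a f u : pval (fun v => a * f v) u = a * pval f u.
Proof. by rewrite !pvalE (eval_okada_valZ (right_basis_s R)). Qed.

Lemma pvalD f f' u : pval (fun v => f v + f' v) u = pval f u + pval f' u.
Proof. by rewrite !pvalE (eval_okada_valD (right_basis_s R)). Qed.

Lemma pval_sum (I : Type) (s : seq I) (F : I -> word -> R) u :
  pval (fun v => \sum_(i <- s) F i v) u = \sum_(i <- s) pval (F i) u.
Proof.
rewrite pvalE (eval_okada_val_sum (right_basis_s R)).
by apply: eq_bigr => i _; rewrite pvalE.
Qed.

Lemma eq_pval f f' u : (forall v, wrank v = wrank u -> f v = f' v) ->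
  pval f u = pval f' u.
Proof.
by rewrite !pvalE; exact: (eq_eval_okada (right_basis_s R) (@okada_deg_p u)).
Qed.

(** Let ∂ be the adjoint of U. The commutation relation gives ∂(xX) = ∂(x)X + x, and ∂(xY) = xX
    because 2v covers exactly the covers of v. With k = [ones u], the coefficient k + 2 in p_{2u} =
    p_u XX - (k + 2) p_u Y is then what makes ∂ kill p_{2u}. *)
Lemma pval_lower_op f u :
  pval (lower_op f) u = (ones u)%:R * pval f (behead u).
Proof.
have step u' : (forall f, pval (lower_op f) u' =
      (ones u')%:R * pval f (behead u')) ->
    forall f, pval (lower_op f) (false :: u') =
      (ones (false :: u'))%:R * pval f u'.
  move=> IH {}f; rewrite pval_one (_ : upper_op _ =
    fun v => lower_op (upper_op f) v + f v); last first.
    by apply/funext => v; exact: upper_lower_op.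
  rewrite pvalD IH ones_one mulrSr mulrDl mul1r.
  congr (_ + _); case: u' {IH} => [|[] u'] /=; rewrite ?mul0r //.
  by rewrite pval_one.
elim: u f => [|[] u IH] f.
- by rewrite pval_nil /lower_op big_nil mul0r.
- rewrite pval_two mul0r (step _ (step _ IH)).
  rewrite (_ : (fun v => _) = upper_op f); last by [].
  by rewrite !ones_one pval_one subrr.
- exact: step.
Qed.

Definition pos_prod g v : R := \prod_(d <- twos v) g d.

Lemma pos_prod_nil g : pos_prod g [::] = 1.
Proof. by rewrite /pos_prod big_nil. Qed.

Lemma pos_prod_one g v : pos_prod g (false :: v) = pos_prod g v.
Proof. by []. Qed.

Lemma pos_prod_two g v :
  pos_prod g (true :: v) = pos_prod g v * g (wrank v).+1.
Proof. by rewrite /pos_prod /= -cats1 big_cat big_seq1. Qed.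

Lemma mem_twos d v : d \in twos v -> (0 < d < wrank v)%N.
Proof.
elim: v => //= -[] v IH; rewrite wrank_cons ?mem_rcons ?inE.
  by case/orP => [/eqP ->|/IH]; lia.
by move/IH; lia.
Qed.

Lemma eq_pos_prod g h v : (forall d, (0 < d < wrank v)%N -> g d = h d) ->
  pos_prod g v = pos_prod h v.
Proof.
move=> gh; rewrite /pos_prod !big_seq; apply: eq_bigr => d /mem_twos; exact: gh.
Qed.

Lemma pos_prodM g h v :
  pos_prod (fun d => g d * h d) v = pos_prod g v * pos_prod h v.
Proof. exact: big_split. Qed.

Lemma pos_prodX g k v : pos_prod (fun d => g d ^+ k) v = pos_prod g v ^+ k.
Proof. exact: prodrXl. Qed.

(* The factor contributed to the value on [okada_p u] by a 2 at position [d]: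
   only the last 2 of [u] at a position at most [d] matters. *)
Fixpoint kappa u (d : nat) : R :=
  if u is b :: u' then
    if b && (wrank u' < d)%N then 1 - (wrank u').+2%:R / d%:R else kappa u' d
  else 1.

(** If [u] contains a 2, the last one has position delta with delta + 1 = |u| - [ones u]; if not,
    [ones u] is |u| and the quotient is 1. *)
Lemma kappa_above u j : (0 < wrank u + j)%N ->
  kappa u (wrank u + j) = (ones u + j)%:R / (wrank u + j)%:R.
Proof.
elim: u j => [|[] u IH] j; rewrite ?wrank_nil ?wrank_cons => hj.
- by rewrite /= divff // pnatr_eq0 -lt0n.
- rewrite /= ifT; last by lia.
  rewrite -[X in X - _](@divff _ (2 + wrank u + j)%:R) ?pnatr_eq0 -?lt0n //.
  by rewrite -mulrBl -natrB; [congr (_%:R / _); rewrite /ones /=; lia|lia].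
- rewrite (_ : (1 + _ + j)%N = (wrank u + j.+1)%N); last by lia.
  by rewrite /= IH ?ones_one ?addSnnS // addnS.
Qed.

Lemma kappa_nseq_cat j u d : kappa (nseq j false ++ u) d = kappa u d.
Proof. by elim: j. Qed.

(** Induction on [w]: D sends the indicator of 1v to that of v, and that of 2v to U of that of v,
    which the derivation evaluates. A removed 2 accounts for the factor |v| + 1 of d(w). *)
Lemma pval_delta w u : wrank u = wrank w ->
  pval (delta w) u = (Defs.dim w)%:R * pos_prod (kappa u) w.
Proof.
elim: w u => [|[] v IH] u; rewrite ?wrank_nil ?wrank_cons.
- by move=> /wrank_eq0 ->; rewrite pval_nil pos_prod_nil dim_nil mulr1 /delta eqxx.
- case: u => [|[] u]; rewrite ?wrank_nil ?wrank_cons // => -[] huv.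
  (* Both words start with 2: the derivation contributes k + 1 and the Y term takes away k + 2. The
     remaining -1 is |v| + 1 times [kappa] at |v| + 1. *)
  + rewrite !add0n in huv.
    have dl : (fun x => delta (true :: v) (true :: x)) = delta v.
      by apply/funext => x; rewrite /delta eqseq_cons.
    rewrite pval_two dl pval_one upper_delta_two pval_lower_op ones_one IH //=.
    rewrite pos_prod_two dim_two /= huv ltnSn.
    rewrite (eq_pos_prod (h := kappa u)) => [|d]; last first.
      by move=> hd; rewrite ltnNge ltnW //; case/andP: hd.
    rewrite [in RHS](_ : (wrank v).+2%:R = (wrank v).+1%:R + 1); last by rewrite -natr1.
    move: (pos_prod (kappa u) v) (Defs.dim v)%:R => a b.
    rewrite [(ones u).+2%:R](_ : _ = (ones u).+1%:R + 1); last by rewrite -natr1.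
    have : (wrank v).+1%:R != 0 :> R by rewrite pnatr_eq0.
    by move: ((wrank v).+1%:R) ((ones u).+1%:R) => c e c0; field.
  + have hv : wrank u = (wrank v).+1 by lia.
    rewrite pval_one upper_delta_two pval_lower_op pos_prod_two dim_two /= -hv.
    rewrite -[kappa u _]/(kappa u (wrank u)) -[X in kappa u X]addn0 kappa_above ?hv //.
    (* If the tail [u] starts with a 2, this 2 sits one position below that of [w], and [kappa]
       vanishes there. *)
    rewrite -hv !addn0; have [z0|z0] := eqVneq (ones u) 0%N.
      by rewrite z0 !mul0r !mulr0.
    case: u z0 hv {huv} => [|[] u] // _ hv; rewrite wrank_cons in hv.
    have {}hv : wrank u = wrank v by case: hv.
    rewrite IH //= wrank_cons hv.
    rewrite -[pos_prod (kappa (false :: u)) v]/(pos_prod (kappa u) v).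
    have : (1 + wrank v)%:R != 0 :> R by rewrite pnatr_eq0.
    by move: (pos_prod (kappa u) v) (Defs.dim v)%:R (ones _)%:R (1 + _)%:R => a b c e e0; field.
- case: u => [|[] u]; rewrite ?wrank_nil ?wrank_cons // => huv.
  + rewrite pval_two (_ : (fun x => _) = fun=> 0); last by apply/funext.
    rewrite pval0 mulr0 subr0 pval_one upper_delta_one.
    rewrite IH ?wrank_cons; last by lia.
    rewrite dim_one pos_prod_one; congr (_ * _); apply: eq_pos_prod => d hd /=.
    by case: ltnP => //; lia.
  + by rewrite pval_one upper_delta_one IH; [rewrite dim_one|lia].
Qed.

Lemma okada_pXn u j : okada_p u * oX ^+ j = okada_p (nseq j false ++ u).
Proof.
elim: j => [|j IH]; first by rewrite expr0 mulr1.
by rewrite exprSr mulrA IH; exact: (esym (okada_p_one (nseq j false ++ u))).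
Qed.

(** Expand Q in the basis p. Multiplying p_u by a power of X puts 1's in front of u, which [kappa]
    does not see, and d(w) cancels. *)
Lemma psi_expand n m w (Q : okada) : wrank w = n -> (m <= n)%N -> okada_deg m Q ->
  psi R n w (Q * oX ^+ (n - m)) = evp (fun u => pos_prod (kappa u) w) Q.
Proof.
move=> wn mn hQ; have hB := right_basis_s R.
rewrite /psi (functional_deg hB); last first.
  by rewrite -[X in okada_deg X](subnKC mn); apply: okada_degM (@okada_degX _).
have -> : (fun v => (v == w)%:R / (Defs.dim w)%:R) = fun v => (Defs.dim w)%:R^-1 * delta w v.
  by apply/funext => v; rewrite mulrC.
rewrite (eval_okada_valZ hB).
pose F x := evs (delta w) (x * oX ^+ (n - m)).
have lF : linear_on setT F.
  by move=> a x y _ _; rewrite /F mulrDl -scalerAl eval_okadaD eval_okadaZ.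
rewrite -[evs _ _]/(F Q) (linear_on_evalT (right_basis_p R) _ lF).
rewrite -(eval_okada_valZ (right_basis_p R)).
apply: (eq_eval_okada (right_basis_p R) hQ) => u um; rewrite /F /= okada_pXn.
rewrite -pvalE pval_delta; last by rewrite wrank_nseq_cat um wn subnK.
rewrite mulKf ?gt_eqF ?dim_gt0 //; apply: eq_pos_prod => d _.
exact: kappa_nseq_cat.
Qed.

(** The weights d(v)/|v|! are harmonic, so a right factor X leaves the value unchanged, while Y
    divides it by |v| + 2. On p_{2u} with no 2 in u, k = |u| and the two terms cancel. *)
Lemma phi_P_p u : phi_P R (okada_p u) = (true \notin u)%:R.
Proof.
rewrite /phi_P (functionalT (right_basis_s R)); set val := fun v => _; rewrite -pvalE.
have hupper : upper_op val = val.
  apply/funext => v; rewrite (@eq_upper_op _ _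
    (fun x => ((wrank v).+1`!)%:R^-1 * (Defs.dim x)%:R)) => [|x xv]; last first.
    by rewrite /val xv mulrC.
  rewrite /upper_op -mulr_sumr -[X in _ * X]/(upper_op _ v) -dim_two_upper dim_two.
  rewrite /val factS natrM.
  have : (wrank v).+1%:R != 0 :> R by rewrite pnatr_eq0.
  have : (wrank v)`!%:R != 0 :> R by rewrite pnatr_eq0 -lt0n fact_gt0.
  by move: ((wrank v).+1%:R) ((wrank v)`!%:R) => a b b0 a0; field; rewrite ?a0 ?b0.
have htwo : (fun v => val (true :: v)) = fun v => ((wrank v).+2)%:R^-1 * val v.
  apply/funext => v; rewrite /val dim_two wrank_cons add2n !factS !natrM.
  have : (wrank v).+1%:R != 0 :> R by rewrite pnatr_eq0.
  have : (wrank v).+2%:R != 0 :> R by rewrite pnatr_eq0.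
  have : (wrank v)`!%:R != 0 :> R by rewrite pnatr_eq0 -lt0n fact_gt0.
  move: ((wrank v).+1%:R) ((wrank v).+2%:R) ((wrank v)`!%:R) => a b c c0 b0 a0.
  by field; rewrite ?a0 ?b0 ?c0.
elim: u => [|[] u IH].
- by rewrite pval_nil /val wrank_nil fact0 dim_nil divr1.
- rewrite pval_two !pval_one !hupper htwo IH.
  rewrite (@eq_pval _ (fun v => ((wrank u).+2)%:R^-1 * val v)) => [|v ->//].
  rewrite pvalZ IH inE eqxx /=.
  have [hu|] := boolP (true \in u); first by rewrite !mulr0 subrr.
  move=> hu; rewrite mulr1 (_ : ones u = wrank u) ?divff ?pnatr_eq0 ?subrr //.
  elim: u hu {IH} => [|[] u IHu]; [by rewrite wrank_nil|by []|].
  by rewrite inE wrank_cons ones_one => /IHu ->.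
- by rewrite pval_one hupper IH inE.
Qed.

Lemma iter_lower_op_expand k phi j v : wrank v = (k + j)%N ->
  \sum_(u <- fset_set (YF k)) phi u * iter j (@lower_op R) (delta u) v =
  iter j (@lower_op R) phi v.
Proof.
elim: j v => [|j IH] v hv /=.
  rewrite (bigD1_seq v) /=; [|by rewrite mem_YF hv addn0|exact: fset_uniq].
  rewrite /delta eqxx mulr1 big1 ?addr0 // => u /negbTE.
  by rewrite eq_sym => ->; rewrite mulr0.
rewrite /lower_op; under eq_bigr do rewrite mulr_sumr.
rewrite exchange_big /= big_seq [RHS]big_seq; apply: eq_bigr => x /wrank_lower xv.
by apply: IH; lia.
Qed.

(** With i = |v| - k, the inner sum over words of rank k is U^i applied to [phi]. *)
Lemma C_betaE beta phi v : C_beta beta phi v =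
  \sum_(i < (wrank v).+1) beta ^+ (wrank v - i) * (1 - beta) ^+ i / (i`!)%:R *
    iter i (@lower_op R) phi v.
Proof.
rewrite /C_beta big_mkord (reindex_inj rev_ord_inj) /=.
apply: eq_bigr => -[i /= hi] _; rewrite subSS subKn //; congr (_ * _).
rewrite fsbig_finite; last exact: finite_YF.
rewrite -(@iter_lower_op_expand (wrank v - i)) ?subnK // !big_seq.
apply: eq_bigr => u uY; congr (_ * _).
have /eqP hu : wrank u == (wrank v - i)%N by rewrite -mem_YF.
by rewrite dim_between_lower_op hu subKn.
Qed.

(** Differentiate the trailing power of X i times and then set X = 1, which is allowed because [phi]
    ignores right factors X. *)
Lemma pval_iter_lower_op phi i u :
  (forall u, pval phi (false :: u) = pval phi u) ->
  pval (iter i (@lower_op R) phi) u = (ones u ^_ i)%:R * pval phi u.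
Proof.
move=> hphi; elim: i u => [|i IH] u; first by rewrite ffactn0 mul1r.
rewrite iterS pval_lower_op IH ffactnS natrM -mulrA.
by case: u => [|[] u] /=; rewrite ?mul0r // ones_one hphi.
Qed.

Lemma phi_w_p W u : phi_w R W (okada_p u) = phi_w_val R W u.
Proof. by rewrite /phi_w (functionalT (right_basis_p R)) (rb_eval (right_basis_p R)). Qed.

(** The falling factorial over i! is a binomial coefficient, zero for i > k = [ones u]; the sum is
    beta^(|u| - k) (beta + (1 - beta))^k. *)
Lemma phi_beta_w_p beta W u : phi_beta_w beta W (okada_p u) =
  beta ^+ (wrank u - ones u) * phi_w_val R W u.
Proof.
rewrite /phi_beta_w (functionalT (right_basis_s R)).
set phi := fun v => phi_w R W (okada_s v).
have phiE u' : pval phi u' = phi_w_val R W u'.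
  rewrite pvalE -(phi_w_p W u') [RHS](linear_on_evalT (right_basis_s R)) // /phi_w.
  by rewrite (functionalT (right_basis_p R)); exact: eval_okada_linear.
have hphi u' : pval phi (false :: u') = pval phi u' by rewrite !phiE.
have hj := ones_le_wrank u; set n := wrank u; set j := ones u.
rewrite -pvalE (@eq_pval _ (fun v =>
  \sum_(i <- index_enum 'I_n.+1) (beta ^+ (n - i) * (1 - beta) ^+ i / (i`!)%:R) *
    iter i (@lower_op R) phi v)) => [|v vn]; last by rewrite C_betaE vn.
rewrite pval_sum.
under eq_bigr do rewrite pvalZ pval_iter_lower_op // phiE mulrA.
rewrite -mulr_suml; congr (_ * _).
rewrite (eq_bigr (fun i : 'I_n.+1 => beta ^+ (n - i) * (1 - beta) ^+ i *+ 'C(j, i))); last first.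
  move=> i _; rewrite -[RHS]mulr_natr -bin_ffact natrM -!mulrA; congr (_ * (_ * _)).
  by rewrite mulrC mulfK // pnatr_eq0 -lt0n fact_gt0.
have e : beta ^+ (n - j) = beta ^+ (n - j) * (beta + (1 - beta)) ^+ j.
  by rewrite addrC subrK expr1n mulr1.
rewrite e exprDn mulr_sumr -(big_mkord xpredT
  (fun i => beta ^+ (n - i) * (1 - beta) ^+ i *+ 'C(j, i))).
rewrite (@big_cat_nat _ _ _ j.+1) //= big_mkord [X in _ + X]big_nat.
rewrite [X in _ + X]big1 ?addr0 => [|i /andP[ji _]]; last by rewrite bin_small ?mulr0n.
apply: eq_bigr => -[i /= hi] _; rewrite mulrnAr mulrA -exprD.
by congr (_ ^+ _ * _ *+ _); lia.
Qed.

End AlgebraicIdentities.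

(** * Products over the positions of the 2's *)

Fixpoint trunc (W : infword) (N : nat) : word :=
  if N is N'.+1 then W N' :: trunc W N' else [::].

Lemma size_trunc W N : size (trunc W N) = N.
Proof. by elim: N => //= N ->. Qed.

Lemma leq_wrank_trunc W N : (N <= wrank (trunc W N))%N.
Proof. by elim: N => //= N IH; rewrite wrank_cons; lia. Qed.

Lemma wposE W N : wpos W N = (wrank (trunc W N)).+1.
Proof.
rewrite /wpos add1n; congr _.+1; elim: N => [|N IH]; first by rewrite big_ord0 wrank_nil.
by rewrite big_ord_recr /= IH wrank_cons addnC.
Qed.

Lemma suffix_trunc W N M : (N <= M)%N -> suffix (trunc W N) (trunc W M).
Proof.
move=> /subnK <-; elim: (M - N)%N => [|k IH]; first exact: suffix_refl.
rewrite addSn /=; have /suffixP[x ->] := IH.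
by apply/suffixP; exists (W (k + N)%N :: x).
Qed.

Definition suffix_converges (x : nat -> word) W : Prop :=
  forall N, \forall n \near \oo, suffix (trunc W N) (x n).

Lemma suffix_converges_trunc W : suffix_converges (trunc W) W.
Proof. by move=> N; exists N => // n /=; exact: suffix_trunc. Qed.

Lemma onth_rev_cat x b (t : word) : onth (rev (rcons x b ++ t)) (size t) = Some b.
Proof.
rewrite rev_cat rev_rcons onthE map_cat nth_cat size_map size_rev ltnn subnn.
by [].
Qed.

Lemma converges_to_suffix (x : nat -> word) W :
  converges_to x W <-> suffix_converges x W.
Proof.
split=> h.
  elim=> [|N IH]; first by apply: nearW => n; exact: suffix0s.
  near=> n; have /suffixP[y hy] : suffix (trunc W N) (x n) by near: n.
  have : onth (rev (x n)) N = Some (W N) by near: n; exact: h.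
  rewrite hy; case/lastP: y hy => [|y b] hy.
    by rewrite /= onthE nth_default // size_map size_rev size_trunc.
  have := onth_rev_cat y b (trunc W N); rewrite size_trunc => -> -[->].
  by apply/suffixP; exists y; rewrite cat_rcons.
move=> m; near=> n; have /suffixP[y ->] : suffix (trunc W m.+1) (x n) by near: n; exact: h.
by have := onth_rev_cat y (W m) (trunc W m); rewrite size_trunc cat_rcons.
Unshelve. all: by end_near. Qed.

Lemma mem_twos_cat d x t : (d <= wrank t)%N -> (d \in twos (x ++ t)) = (d \in twos t).
Proof.
move=> dt; elim: x => [//|[] x IH] //=; rewrite mem_rcons inE IH.
by case: eqP => // e; move: dt; rewrite e wrank_cat; lia.
Qed.

Lemma mem_twos_digit x b t : ((wrank t).+1 \in twos (x ++ b :: t)) = b.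
Proof.
rewrite mem_twos_cat; last by rewrite wrank_cons; lia.
case: b => /=; first by rewrite mem_rcons mem_head.
by apply/negbTE/negP => /mem_twos; lia.
Qed.

(** A 2 takes up two units of rank, so the next 2 is at least two positions further. *)
Lemma twos_gap d v : d \in twos v -> d.+1 \notin twos v.
Proof.
elim: v => //= -[] v IH //; rewrite !mem_rcons !inE negb_or.
case/orP => [/eqP ->|hd].
  by apply/andP; split; [lia|apply/negP => /mem_twos; lia].
by rewrite IH // andbT; have := mem_twos hd; lia.
Qed.

Section Products.
Variable R : realType.
Implicit Types (u v : word) (W : infword) (g h : nat -> R).

Lemma pos_prod_trunc g W N :
  pos_prod g (trunc W N) = \prod_(i < N | W i) g (wpos W i).
Proof.
elim: N => [|N IH]; first by rewrite big_ord0 pos_prod_nil.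
rewrite big_mkcond big_ord_recr /= -big_mkcond -IH wposE.
by case: (W N); rewrite ?mulr1 // pos_prod_two.
Qed.

Lemma pos_prod_ge0 g v : (forall d, (0 < d)%N -> 0 <= g d) -> 0 <= pos_prod g v.
Proof.
move=> h; rewrite /pos_prod big_seq; apply: prodr_ge0 => d /mem_twos/andP[d0 _].
exact: h.
Qed.

Lemma pos_prod_gt0 g v : (forall d, (0 < d)%N -> 0 < g d) -> 0 < pos_prod g v.
Proof.
move=> h; rewrite /pos_prod big_seq; apply: prodr_gt0 => d /mem_twos/andP[d0 _].
exact: h.
Qed.

Lemma ler_pos_prod g h v : (forall d, d \in twos v -> 0 <= g d <= h d) ->
  pos_prod g v <= pos_prod h v.
Proof. by move=> H; rewrite /pos_prod !big_seq; apply: ler_prod. Qed.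

Lemma pos_prod_norm g v : `|pos_prod g v| = pos_prod (fun d => `|g d|) v.
Proof. exact: normr_prod. Qed.

Lemma pos_prod_le1 g v : (forall d, (0 < d)%N -> 0 <= g d <= 1) -> pos_prod g v <= 1.
Proof.
move=> h; elim: v => [|[] v IH]; rewrite ?pos_prod_nil ?pos_prod_one //.
have /andP[g0 g1] := h (wrank v).+1 isT.
rewrite pos_prod_two mulr_ile1 // pos_prod_ge0 // => d /h /andP[]; done.
Qed.

Lemma pos_prod_cat_le g x t : (forall d, (0 < d)%N -> 0 <= g d <= 1) ->
  pos_prod g (x ++ t) <= pos_prod g t.
Proof.
move=> h; elim: x => [//|[] x IH] //=; rewrite pos_prod_two.
have /andP[g0 g1] := h (wrank (x ++ t)).+1 isT.
apply: le_trans IH; rewrite -[leRHS]mulr1 ler_wpM2l // pos_prod_ge0 // => d.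
by move/h/andP => [].
Qed.

Lemma pos_prod_cat1 g x t : (forall d, (wrank t < d)%N -> g d = 1) ->
  pos_prod g (x ++ t) = pos_prod g t.
Proof.
move=> h; elim: x => [//|[] x IH] //=.
by rewrite pos_prod_two IH h ?mulr1 // wrank_cat; lia.
Qed.

(** All partial products lie in [0, 1], so a factor g d costs at most 1 - g d; the hypothesis makes
    these losses telescope along the rank. *)
Lemma pos_prod_cat_ge g C x t : 0 <= C -> (0 < wrank t)%N ->
  (forall d, (0 < d)%N -> 0 <= g d <= 1) ->
  (forall d, (0 < d)%N -> 1 - g d.+1 <= C * (d%:R^-1 - d.+1%:R^-1)) ->
  pos_prod g t - C * ((wrank t)%:R^-1 - (wrank (x ++ t))%:R^-1) <= pos_prod g (x ++ t).
Proof.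
move=> C0 t0 h hC; elim: x => [|b x IH]; first by rewrite subrr mulr0 subr0.
set r := wrank (x ++ t) in IH *; have r0 : (0 < r)%N by rewrite /r wrank_cat; lia.
have inv k : (r <= k)%N -> k%:R^-1 <= r%:R^-1 :> R.
  by move=> rk; rewrite lef_pV2 ?posrE ?ltr0n ?ler_nat //; lia.
rewrite cat_cons wrank_cons -/r; case: b => /=.
  have /andP[g0 g1] := h r.+1 isT; rewrite pos_prod_two -/r.
  have P1 := pos_prod_le1 (x ++ t) h.
  have P0 : 0 <= pos_prod g (x ++ t) by apply: pos_prod_ge0 => d /h /andP[].
  have : (2 + r)%:R^-1 <= r.+1%:R^-1 :> R.
    by rewrite lef_pV2 ?posrE ?ltr0n ?ler_nat.
  have := hC r r0.
  move: (pos_prod g _) (pos_prod g t) (g _) (wrank t)%:R^-1 r%:R^-1 r.+1%:R^-1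
    (2 + r)%:R^-1 IH P0 P1 g0 g1 => P Pt gr a b c e; nra.
rewrite pos_prod_one; apply: le_trans IH; rewrite lerD2l lerN2 ler_wpM2l // lerD2l lerN2.
by apply: inv; lia.
Qed.

Lemma nonincreasing_pos_prod g W : (forall d, (0 < d)%N -> 0 <= g d <= 1) ->
  cvgn (fun N => pos_prod g (trunc W N)).
Proof.
move=> h; apply: nonincreasing_is_cvgn.
  by move=> N M /(suffix_trunc W)/suffixP[x ->]; exact: pos_prod_cat_le.
by exists 0 => _ [N _ <-]; apply: pos_prod_ge0 => d /h /andP[].
Qed.

Lemma suffix_converges_pos_prod1 g D (x : nat -> word) W : suffix_converges x W ->
  (forall d, (D < d)%N -> g d = 1) ->
  pos_prod g (x n) @[n --> \oo] --> pos_prod g (trunc W D).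
Proof.
move=> hx h1; apply: cvg_near_cst; near=> n.
have /suffixP[y ->] : suffix (trunc W D) (x n) by near: n; exact: hx.
by rewrite pos_prod_cat1 // => d hd; apply: h1; have := leq_wrank_trunc W D; lia.
Unshelve. all: by end_near. Qed.

(** A suffix of N letters fixes the product up to C/N, uniformly in the letters further left; hence
    the limit depends on [W] alone. *)
Lemma suffix_converges_pos_prod g C (x : nat -> word) W : suffix_converges x W -> 0 <= C ->
  (forall d, (0 < d)%N -> 0 <= g d <= 1) ->
  (forall d, (0 < d)%N -> 1 - g d.+1 <= C * (d%:R^-1 - d.+1%:R^-1)) ->
  pos_prod g (x n) @[n --> \oo] --> limn (fun N => pos_prod g (trunc W N)).
Proof.
move=> hx C0 h hC; set L := limn _.
have cL : pos_prod g (trunc W N) @[N --> \oo] --> L by exact: nonincreasing_pos_prod.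
have close N v : (0 < N)%N -> suffix (trunc W N) v ->
    pos_prod g (trunc W N) - C / N%:R <= pos_prod g v <= pos_prod g (trunc W N).
  move=> N0 /suffixP[y ->]; rewrite pos_prod_cat_le // andbT.
  have tN := leq_wrank_trunc W N.
  apply: le_trans (pos_prod_cat_ge y C0 _ h hC); last exact: leq_trans tN.
  rewrite lerD2l lerN2 ler_wpM2l //.
  apply: (@le_trans _ _ (wrank (trunc W N))%:R^-1); first by rewrite gerBl.
  by rewrite lef_pV2 ?posrE ?ltr0n ?ler_nat //; apply: leq_trans tN.
apply/cvgrPdist_le => e e0.
have [N N0 CN] : exists2 N, (0 < N)%N & C / N%:R <= e.
  exists (Num.bound (C / e)).+1 => //; rewrite ler_pdivrMr ?ltr0n // mulrC -ler_pdivrMr //.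
  apply: le_trans (_ : (Num.bound (C / e))%:R <= _); last by rewrite ler_nat.
  by apply: ltW; apply: le_lt_trans (archi_boundP _); rewrite ?ler_norm ?divr_ge0 // ltW.
have LN : pos_prod g (trunc W N) - C / N%:R <= L <= pos_prod g (trunc W N).
  apply/andP; split; [apply: limr_ge|apply: limr_le]; first exact: cvgP cL.
  - by exists N => // M /= NM; have /andP[] := close N _ N0 (suffix_trunc W NM).
  - exact: cvgP cL.
  - by exists N => // M /= NM; have /andP[] := close N _ N0 (suffix_trunc W NM).
near=> n; have /(close _ _ N0)/andP[a1 a2] : suffix (trunc W N) (x n) by near: n; exact: hx.
by case/andP: LN => b1 b2; rewrite ler_norml; apply/andP; split; lra.
Unshelve. all: by end_near. Qed.

(** The factors at positions up to D are arbitrary, but their product is eventually constant; the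
    remaining product is monotone. *)
Lemma is_cvg_pos_prod g D W : (forall d, (D < d)%N -> 0 <= g d <= 1) ->
  cvgn (fun N => pos_prod g (trunc W N)).
Proof.
move=> h; pose g1 d := if (d <= D)%N then g d else 1.
pose g2 d := if (d <= D)%N then 1 else g d.
have -> : (fun N => pos_prod g (trunc W N)) =
    (fun N => pos_prod g1 (trunc W N) * pos_prod g2 (trunc W N)).
  apply/funext => N; rewrite -pos_prodM; apply: eq_pos_prod => d _.
  by rewrite /g1 /g2; case: ifP; rewrite ?mulr1 ?mul1r.
apply: is_cvgM.
  apply: cvgP; apply: (@suffix_converges_pos_prod1 _ D _ W).
    exact: suffix_converges_trunc.
  by move=> d hd; rewrite /g1 leqNgt hd.
apply: nonincreasing_pos_prod => d _; rewrite /g2; case: leqP => [|/h //].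
by rewrite ler01 lexx.
Qed.

Lemma bernoulli_le (x : R) n : 0 <= x <= 1 -> 1 - n%:R * x <= (1 - x) ^+ n.
Proof.
move=> /andP[x0 x1]; elim: n => [|n IH]; first by rewrite mul0r subr0.
have n0 : 0 <= n%:R :> R by [].
rewrite exprS -natr1; move: ((1 - x) ^+ n) n%:R n0 IH => y m m0 IH.
have : (1 - x) * (1 - m * x) <= (1 - x) * y by rewrite ler_wpM2l //; lra.
by apply: le_trans; nra.
Qed.

Lemma bernoulli_inv (x : R) n : 0 <= x <= 1 -> (1 - x) ^+ n * (1 + n%:R * x) <= 1.
Proof.
move=> /andP[x0 x1]; elim: n => [|n IH]; first by rewrite mul0r addr0 mulr1.
have n0 : 0 <= n%:R :> R by [].
have y0 : 0 <= (1 - x) ^+ n by rewrite exprn_ge0 //; lra.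
rewrite exprS -natr1; move: ((1 - x) ^+ n) n%:R n0 y0 IH => y m m0 y0 IH.
apply: le_trans IH; rewrite -mulrA mulrCA ler_wpM2l //; nra.
Qed.

Definition pi_factor (d : nat) : R := if (2 <= d)%N then 1 - d%:R^-1 else 1.

Lemma pi_finE v : pi_fin R v = pos_prod pi_factor v.
Proof. exact: big_mkcond. Qed.

Lemma invn_bound d : (0 < d)%N -> 0 <= (d%:R^-1 : R) <= 1.
Proof. by move=> d0; rewrite invr_ge0 ler0n /= invf_le1 ?ltr0n // ler1n. Qed.

Lemma inv2_bound d : (2 <= d)%N -> (d%:R^-1 : R) <= 2^-1.
Proof. by move=> d2; rewrite lef_pV2 ?posrE ?ltr0n ?ler_nat //; lia. Qed.

Lemma pi_factor_ge d : 2^-1 <= pi_factor d.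
Proof.
rewrite /pi_factor; case: ifP => [/inv2_bound|_]; last by rewrite invf_le1 ?ler1n.
by lra.
Qed.

Lemma pi_factor_bound d : (0 < d)%N -> 0 <= pi_factor d <= 1.
Proof.
move=> d0; have := pi_factor_ge d; rewrite /pi_factor; case: ifP => _ h.
  by have := invn_bound d0; lra.
by rewrite ler01 lexx.
Qed.

Lemma pi_fin_ge0 v : 0 <= pi_fin R v.
Proof. by rewrite pi_finE; apply: pos_prod_ge0 => d /pi_factor_bound /andP[]. Qed.

Lemma pi_fin_le1 v : pi_fin R v <= 1.
Proof. by rewrite pi_finE; apply: pos_prod_le1 => d /pi_factor_bound. Qed.

Lemma pi_fin_cat_le x t : pi_fin R (x ++ t) <= pi_fin R t.
Proof. by rewrite !pi_finE; apply: pos_prod_cat_le => d /pi_factor_bound. Qed.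

Lemma pi_infE W : pi_inf R W = limn (fun N => pi_fin R (trunc W N)).
Proof.
rewrite /pi_inf; congr (limn _); apply/funext => N.
rewrite pi_finE pos_prod_trunc big_mkcondr; apply: eq_bigr => i _.
by rewrite /pi_factor.
Qed.

Lemma cvg_pi_trunc W : pi_fin R (trunc W N) @[N --> \oo] --> pi_inf R W.
Proof.
rewrite pi_infE; under [X in X @ _]eq_fun do rewrite pi_finE.
by apply: (@is_cvg_pos_prod _ 0) => d /pi_factor_bound.
Qed.

End Products.

(** * Comparing the values on the basis p with powers of pi *)

Section Factorization.
Variable R : realType.
Implicit Types (u v : word) (W : infword) (g h : nat -> R).
Local Notation kappa := (@kappa R).

(* One more than the largest position of a 2 in [u], or 0 if there is none. *)
Definition top u : nat := (wrank u - ones u)%N.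

Lemma kappa_top u d : (0 < d)%N -> (top u <= d)%N ->
  kappa u d = 1 - (top u)%:R / d%:R.
Proof.
move=> d0; elim: u => [|[] u IH]; rewrite /top.
- by rewrite wrank_nil mul0r subr0.
- by rewrite wrank_cons subn0 /= => hd; rewrite ifT //; lia.
- by rewrite ones_one wrank_cons subSS => /IH.
Qed.

Lemma kappa_no_two u d : true \notin u -> kappa u d = 1.
Proof. by elim: u => [|[] u IH] //; rewrite inE => /IH. Qed.

Lemma top_gt1 u : true \in u -> (1 < top u)%N.
Proof.
elim: u => [|[] u IH] //; rewrite /top wrank_cons; first by rewrite subn0; lia.
by rewrite inE ones_one subSS => /IH.
Qed.

Lemma kappa_norm_le1 u d : `|kappa u d| <= 1.
Proof.
elim: u => [|[] u IH] /=; rewrite ?normr1 //; case: ifP => //= ud.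
have d0 : 0 < d%:R :> R by rewrite ltr0n; lia.
have h : 0 <= ((wrank u).+2%:R / d%:R : R) <= 2.
  by rewrite divr_ge0 //= ler_pdivrMr // -natrM ler_nat; lia.
by rewrite ler_norml; lra.
Qed.

(** With x = 1/d, [bernoulli_inv] bounds the left side by 1/(1 + r(r+1)x), and (1 - rx)(1 + r(r+1)x)
    = 1 + r^2 x (1 - (r+1)x) is at least 1 as soon as d > r. *)
Lemma pow_pi_factor_le r d : (r < d)%N ->
  (1 - d%:R^-1) ^+ (r * r.+1) <= 1 - r%:R / d%:R :> R.
Proof.
move=> rd; have hx := invn_bound R (leq_ltn_trans (leq0n r) rd).
have hr : r.+1%:R * d%:R^-1 <= 1 :> R by rewrite ler_pdivrMr ?ltr0n ?mul1r ?ler_nat //; lia.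
have := bernoulli_inv (r * r.+1) hx; rewrite natrM -natr1.
rewrite -natr1 in hr; have r0 : 0 <= r%:R :> R by [].
move: (_ ^+ (r * r.+1)) => y hy.
move: (d%:R^-1) (r%:R) r0 hr hx hy => x m m0 hr /andP[x0 x1] hy.
have c0 : 0 < 1 + m * (m + 1) * x by have := mulr_ge0 (mulr_ge0 m0 (addr_ge0 m0 ler01)) x0; lra.
rewrite -(ler_pM2r c0); apply: le_trans hy _.
have h1 : 0 <= m * m * x * (1 - (m + 1) * x).
  by rewrite !mulr_ge0 // subr_ge0.
by move: h1; clear; lra.
Qed.

(** For d < r + 2, where 1 - r/d may be negative and 1 - 1/d zero, the factor is set to 1;
    [kappa_factorization] treats these finitely many positions separately. *)
Definition ratio_factor r d : R :=
  if (d < r.+2)%N then 1 else (1 - r%:R / d%:R) / (1 - d%:R^-1) ^+ r.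

Lemma ratio_factor_bound r d : 0 <= ratio_factor r d <= 1.
Proof.
rewrite /ratio_factor; case: ltnP => [_|rd]; first by rewrite ler01 lexx.
have hx := invn_bound R (leq_ltn_trans (leq0n r.+1) rd).
have h2 := inv2_bound R (leq_trans (isT : (2 <= r.+2)%N) rd).
have y0 : 0 < (1 - d%:R^-1 : R) ^+ r by rewrite exprn_gt0 //; lra.
rewrite ler_pdivrMr // mul1r bernoulli_le // andbT divr_ge0 ?(ltW y0) //.
by rewrite subr_ge0 ler_pdivrMr ?ltr0n ?mul1r ?ler_nat; lia.
Qed.

(** With x = 1/(d+1), [bernoulli_inv] bounds the ratio below by (1 - rx)(1 + rx), and x^2 is at most
    1/d - 1/(d+1). This is the hypothesis of [suffix_converges_pos_prod] with C = r^2. *)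
Lemma ratio_factor_close r d : (0 < d)%N ->
  1 - ratio_factor r d.+1 <= (r ^ 2)%:R * (d%:R^-1 - d.+1%:R^-1).
Proof.
move=> d0; have le1 : (d.+1%:R^-1 : R) <= d%:R^-1.
  by rewrite lef_pV2 ?posrE ?ltr0n ?ler_nat.
rewrite /ratio_factor; case: ltnP => [_|rd].
  by rewrite subrr mulr_ge0 // subr_ge0.
have hx := invn_bound R (isT : (0 < d.+1)%N).
have h2 : (d.+1%:R^-1 : R) <= 2^-1 by apply: inv2_bound.
have y0 : 0 < (1 - d.+1%:R^-1 : R) ^+ r.
  by rewrite exprn_gt0 // subr_gt0 (le_lt_trans h2) // invf_lt1 ?ltr1n.
have hb := bernoulli_inv r hx.
have hr : 0 <= 1 - r%:R / d.+1%:R :> R.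
  by rewrite subr_ge0 ler_pdivrMr ?ltr0n ?mul1r ?ler_nat; lia.
have lo : (1 - r%:R / d.+1%:R) * (1 + r%:R / d.+1%:R) <=
    (1 - r%:R / d.+1%:R) / (1 - d.+1%:R^-1) ^+ r :> R.
  by rewrite ler_wpM2l // -[X in _ <= X]mul1r ler_pdivlMr // mulrC.
have diff : (d.+1%:R^-1 : R) ^+ 2 <= d%:R^-1 - d.+1%:R^-1.
  have -> : d%:R^-1 - d.+1%:R^-1 = d%:R^-1 * d.+1%:R^-1 :> R.
    have e : d.+1%:R = d%:R + 1 :> R by rewrite natr1.
    by rewrite e; field; rewrite -e !pnatr_eq0 -!lt0n d0.
  by rewrite expr2 ler_wpM2r // invr_ge0.
rewrite natrX; move: diff lo; clear -R.
move: ((1 - r%:R / _) / _) => z; move: (d%:R^-1 - _) => D; move: d.+1%:R^-1 => x.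
move=> hD hz; have : r%:R ^+ 2 * x ^+ 2 <= r%:R ^+ 2 * D by rewrite ler_wpM2l // sqr_ge0.
by rewrite !expr2 in hz *; lra.
Qed.

Lemma cvg_expn (f : nat -> R) (l : R) k : f n @[n --> \oo] --> l ->
  f n ^+ k @[n --> \oo] --> l ^+ k.
Proof.
move=> fl; elim: k => [|k IH].
  by under eq_fun do rewrite expr0; exact: cvg_cst.
by under eq_fun do rewrite exprS; rewrite exprS; exact: cvgM.
Qed.

(** [m] collects the values of [kappa] at small positions, the ratios at large ones, and a
    correction for the small factors of pi. M is fixed before the sequence [x], so that all
    sequences converging to [W], its truncations included, share it. *)
Lemma kappa_factorization u : exists m : word -> R,
  (forall v, pos_prod (kappa u) v = m v * pi_fin R v ^+ top u) /\
  forall W, exists M : R, forall x, suffix_converges x W -> m (x n) @[n --> \oo] --> M.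
Proof.
set r := top u.
pose k1 d := if (d < r.+2)%N then kappa u d else 1.
pose e1 d := if (d < r.+2)%N then pi_factor R d else 1.
pose e2 d := if (d < r.+2)%N then 1 else pi_factor R d.
have e1_gt0 v : 0 < pos_prod e1 v.
  apply: pos_prod_gt0 => d _; rewrite /e1; case: ifP => // _.
  by apply: lt_le_trans (pi_factor_ge R d); rewrite invr_gt0.
exists (fun v => pos_prod k1 v * pos_prod (ratio_factor r) v * (pos_prod e1 v ^+ r)^-1).
split=> [v|W].
  have -> : pi_fin R v = pos_prod e1 v * pos_prod e2 v.
    rewrite pi_finE -pos_prodM; apply: eq_pos_prod => d _.
    by rewrite /e1 /e2; case: ifP; rewrite ?mulr1 ?mul1r.
  rewrite exprMn mulrA mulfVK ?expf_neq0 ?gt_eqF // -pos_prodX -!pos_prodM.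
  apply: eq_pos_prod => d /andP[d0 _]; rewrite /k1 /ratio_factor /e2.
  case: ltnP => rd; first by rewrite expr1n !mulr1.
  rewrite mul1r /pi_factor ifT; last by lia.
  have h2 := inv2_bound R (leq_trans (isT : (2 <= r.+2)%N) rd).
  rewrite mulfVK; last by rewrite expf_neq0 // gt_eqF //; lra.
  by rewrite kappa_top //; rewrite -/r; lia.
eexists => x hx; apply: cvgM; first apply: cvgM.
- by apply: (suffix_converges_pos_prod1 (D := r.+2) hx) => d hd; rewrite /k1 ltnNge ltnW.
- apply: (suffix_converges_pos_prod (C := (r ^ 2)%:R) hx) => // d d0.
    exact: ratio_factor_bound.
  exact: ratio_factor_close.
- apply: cvgV; last first.
    apply: cvg_expn; apply: (suffix_converges_pos_prod1 (D := r.+2) hx) => d hd.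
    by rewrite /e1 ltnNge ltnW.
  by rewrite expf_neq0 // gt_eqF.
Qed.

Definition interval_factor u i d : R :=
  if (nth 0%N (twos u) i <= d)%N &&
     ((i.+1 < size (twos u))%N ==> (d < nth 0%N (twos u) i.+1)%N)
  then 1 - (nth 0%N (twos u) i).+1%:R / d%:R else 1.

(** The intervals between successive 2's of [u] are disjoint, so at most one factor differs from 1.
    A new leading 2 closes the interval that was unbounded before. *)
Lemma prod_interval_factor u d :
  \prod_(0 <= i < size (twos u)) interval_factor u i d = kappa u d.
Proof.
elim: u => [|[] u IH] /=; first by rewrite big_geq.
  rewrite size_rcons big_nat_recr //= -IH; set t := twos u; set p := (wrank u).+1.
  have last_factor : interval_factor (true :: u) (size t) d =
      if (p <= d)%N then 1 - p.+1%:R / d%:R else 1.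
    rewrite /interval_factor /= -/t -/p size_rcons ltnn /= andbT.
    by rewrite nth_rcons ltnn eqxx.
  rewrite last_factor; case: ltnP => pd.
    rewrite big_nat big1 ?mul1r // => i /andP[_ it].
    rewrite /interval_factor /= -/t -/p size_rcons ltnS it /=.
    rewrite [X in _ && X](_ : _ = false) ?andbF //; apply/negbTE; rewrite -leqNgt.
    have : nth 0%N (rcons t p) i.+1 \in rcons t p.
      by rewrite mem_nth // size_rcons ltnS.
    rewrite mem_rcons inE => /orP[/eqP ->|/mem_twos]; rewrite ?/p; lia.
  rewrite mulr1 !big_nat; apply: eq_bigr => i /andP[_ it].
  rewrite /interval_factor /= -/t -/p size_rcons !nth_rcons it ltnS it.
  congr (if _ && _ then _ else _); case: (ltnP i.+1 (size t)) => // ti.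
  by rewrite (_ : i.+1 = size t) ?eqxx /=; lia.
exact: IH.
Qed.

Lemma cvg_prod_seq (I : Type) (s : seq I) (F : nat -> I -> R) (l : I -> R) :
  (forall i, F n i @[n --> \oo] --> l i) ->
  \prod_(i <- s) F n i @[n --> \oo] --> \prod_(i <- s) l i.
Proof.
move=> h; elim: s => [|i s IH].
  by rewrite big_nil; under eq_fun do rewrite big_nil; exact: cvg_cst.
by rewrite big_cons; under eq_fun do rewrite big_cons; exact: cvgM.
Qed.

Lemma phi_w_val_cvg W u :
  pos_prod (kappa u) (trunc W N) @[N --> \oo] --> phi_w_val R W u.
Proof.
have fE i N : pos_prod (interval_factor u i) (trunc W N) =
  \prod_(l < N | [&& W l, (nth 0%N (twos u) i <= wpos W l)%N
         & (i.+1 < size (twos u))%N ==> (wpos W l < nth 0%N (twos u) i.+1)%N])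
    (1 - (nth 0%N (twos u) i).+1%:R / (wpos W l)%:R).
  by rewrite pos_prod_trunc [RHS]big_mkcondr.
have -> : (fun N => pos_prod (kappa u) (trunc W N)) = fun N =>
    \prod_(i <- index_iota 0 (size (twos u))) pos_prod (interval_factor u i) (trunc W N).
  apply/funext => N; rewrite /pos_prod exchange_big /=.
  by apply: eq_bigr => d _; rewrite prod_interval_factor.
rewrite /phi_w_val; apply: cvg_prod_seq => i.
under [X in _ --> limn X]eq_fun do rewrite -fE.
(* At d = delta_i the factor is -1/delta_i; only beyond it do the factors lie in [0, 1]. *)
apply: (is_cvg_pos_prod (D := nth 0%N (twos u) i)) => d hd.
rewrite /interval_factor; case: ifP => _; last by rewrite ler01 lexx.
have d0 : 0 < d%:R :> R by rewrite ltr0n; lia.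
have : 0 <= ((nth 0%N (twos u) i).+1%:R / d%:R : R) <= 1.
  by rewrite divr_ge0 //= ler_pdivrMr // mul1r ler_nat.
by lra.
Qed.

(** The sequence and the truncations of [W] have the same M, so their limits differ only by the
    ratio of the powers of pi, which is a power of beta. *)
Lemma kappa_cvg_ii u x W beta : condition_ii x W beta ->
  pos_prod (kappa u) (x n) @[n --> \oo] --> beta ^+ top u * phi_w_val R W u.
Proof.
move=> [/converges_to_suffix hx _ cpi be b0].
have [m [mE /(_ W)[M mM]]] := kappa_factorization u.
(* The inverse of 0 is 0, which would make beta zero. *)
have piW0 : pi_inf R W != 0.
  by apply: contraL b0 => /eqP z; rewrite be z invr0 mul0r ltxx.
have -> : beta ^+ top u * phi_w_val R W u = M * (limn (fun n => pi_fin R (x n))) ^+ top u.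
  have -> : phi_w_val R W u = M * pi_inf R W ^+ top u.
    rewrite -(cvg_lim (@norm_hausdorff _ _) (@phi_w_val_cvg W u)); apply: cvg_lim => //.
    under eq_fun do rewrite mE; apply: cvgM; first exact/mM/suffix_converges_trunc.
    exact/cvg_expn/cvg_pi_trunc.
  by rewrite be mulrCA -exprMn mulrAC mulVf // mul1r.
under eq_fun do rewrite mE; apply: cvgM; first exact: mM.
exact: cvg_expn.
Qed.

(** Beyond [top u], 1 - r/d is at most 1 - 1/d. At the positions up to [top u], [kappa] is at most 1
    in absolute value and the factor of pi at least 1/2, so each costs at most a factor 2. *)
Lemma kappa_le_pi u v : true \in u ->
  `|pos_prod (kappa u) v| <= 2 ^+ top u * pi_fin R v.
Proof.
move=> /top_gt1 t1; pose c d : R := if (d <= top u)%N then 2 else 1.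
have cv : pos_prod c v <= 2 ^+ minn (wrank v) (top u).
  elim: v => [|b v IH]; first by rewrite pos_prod_nil wrank_nil min0n.
  have mono k l : (k <= l)%N -> (2 : R) ^+ minn k (top u) <= 2 ^+ minn l (top u).
    by move=> kl; rewrite ler_weXn2l ?ler1n // geq_min leq_min; lia.
  case: b; last first.
    by rewrite pos_prod_one wrank_cons; apply: le_trans IH (mono _ _ _); lia.
  have cE : c (wrank v).+1 = if (wrank v < top u)%N then 2 else 1 by [].
  rewrite pos_prod_two wrank_cons cE; case: ltnP => h.
    apply: (@le_trans _ _ (2 ^+ minn (wrank v) (top u) * 2)); first by rewrite ler_pM2r.
    by rewrite -exprSr ler_weXn2l ?ler1n //; lia.
  by rewrite mulr1; apply: le_trans IH (mono _ _ _); lia.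
apply: (@le_trans _ _ (pos_prod c v * pi_fin R v)); last first.
  rewrite ler_wpM2r ?pi_fin_ge0 //; apply: le_trans cv _.
  by rewrite ler_weXn2l ?ler1n // geq_minr.
rewrite pos_prod_norm pi_finE -pos_prodM; apply: ler_pos_prod => d /mem_twos/andP[d0 _].
rewrite normr_ge0 /= /c; case: leqP => h.
  by apply: le_trans (kappa_norm_le1 u d) _; have := pi_factor_ge R d; lra.
have dp : 0 < d%:R :> R by rewrite ltr0n.
rewrite mul1r (kappa_top d0 (ltnW h)) /pi_factor ifT; last by lia.
rewrite ger0_norm; first by rewrite lerD2l lerN2 -[leLHS]mul1r ler_wpM2r ?invr_ge0 ?ler1n //; lia.
by rewrite subr_ge0 ler_pdivrMr // mul1r ler_nat (ltnW h).
Qed.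

Lemma kappa_cvg_i u x : condition_i R x ->
  pos_prod (kappa u) (x n) @[n --> \oo] --> ((true \notin u)%:R : R).
Proof.
move=> hx; have [hu|hu] := boolP (true \in u); last first.
  have kE v : pos_prod (kappa u) v = 1.
    by rewrite /pos_prod big1 // => d _; exact: kappa_no_two.
  by under eq_fun do rewrite kE; exact: cvg_cst.
apply/norm_cvg0P.
apply: (@squeeze_cvgr _ _ _ _ (fun=> 0) (fun n => 2 ^+ top u * pi_fin R (x n))).
- by apply: nearW => n; rewrite normr_ge0 kappa_le_pi.
- exact: cvg_cst.
- by rewrite -[X in _ --> X](mulr0 (2 ^+ top u : R)); apply: cvgMr.
Qed.

End Factorization.

(** * The converse *)

Section SingleTwo.
Variable R : realType.
Implicit Types (u v : word) (W : infword).

(** The only 2 has position k + 1; the limits for these words suffice for the converse. *)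
Definition two_ones (k : nat) : word := true :: nseq k false.

Definition single (k : nat) v : R := pos_prod (@kappa R (two_ones k)) v.

Lemma wrank_nseq k : wrank (nseq k false) = k.
Proof. by rewrite -[nseq k false]cats0 wrank_nseq_cat wrank_nil addn0. Qed.

Lemma kappa_two_ones k d :
  kappa R (two_ones k) d = if (k < d)%N then 1 - k.+2%:R / d%:R else 1.
Proof. by rewrite /= wrank_nseq; case: ifP => // _; elim: k. Qed.

Lemma top_two_ones k : top (two_ones k) = k.+2.
Proof. by rewrite /top wrank_cons wrank_nseq subn0. Qed.

Lemma pos_prod_point (z : R) p v :
  pos_prod (fun d => if d == p then z else 1) v = if p \in twos v then z else 1.
Proof.
elim: v => [|[] v IH] //=; first by rewrite pos_prod_nil.
rewrite pos_prod_two IH mem_rcons inE [p == _]eq_sym; case: eqP => [<-|_] /=.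
  rewrite (_ : _ \in twos v = false) ?mul1r //.
  by apply/negbTE/negP => /mem_twos; lia.
by rewrite mulr1.
Qed.

(** The absolute value of [kappa] for this word: it is negative only at d = k + 1, so the sign of
    [single k] detects a 2 there. *)
Definition single_abs k d : R :=
  if d == k.+1 then k.+1%:R^-1 else if (k < d)%N then 1 - k.+2%:R / d%:R else 1.

Lemma single_abs_ge0 k d : 0 <= single_abs k d.
Proof.
rewrite /single_abs; case: eqP => [_|dk]; first by rewrite invr_ge0.
case: ltnP => // kd; rewrite subr_ge0 ler_pdivrMr ?ltr0n ?mul1r ?ler_nat; lia.
Qed.

Lemma singleE k v :
  single k v = (if k.+1 \in twos v then -1 else 1) * pos_prod (single_abs k) v.
Proof.
rewrite -pos_prod_point -pos_prodM; apply: eq_pos_prod => d _.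
rewrite kappa_two_ones /single_abs; case: eqP => [->|_]; last by rewrite mul1r.
have k0 : k.+1%:R != 0 :> R by rewrite pnatr_eq0.
by rewrite ltnSn -[k.+2%:R]natr1; move: (k.+1%:R) k0 => x x0; field.
Qed.

Lemma single_norm k v : `|single k v| = pos_prod (single_abs k) v.
Proof.
rewrite singleE normrM [X in _ * X]ger0_norm.
  by case: ifP; rewrite ?normrN normr1 mul1r.
by apply: pos_prod_ge0 => d _; exact: single_abs_ge0.
Qed.

Lemma single_le_pi k v : `|single k v| <= 2 ^+ k.+2 * pi_fin R v.
Proof. have h : true \in two_ones k by rewrite inE.
by have := kappa_le_pi R v h; rewrite top_two_ones. Qed.

(** [pow_pi_factor_le] with r = k + 2 handles each factor beyond position k + 1. Position k + 2 is
    excluded because the factor vanishes there. *)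
Lemma single_ge_pi k v : k.+2 \notin twos v ->
  k.+1%:R^-1 * pi_fin R v ^+ (k.+2 * k.+3) <= `|single k v|.
Proof.
move=> hk; rewrite single_norm pi_finE -pos_prodX.
have inv1 : (k.+1%:R^-1 : R) <= 1 by rewrite invf_le1 ?ltr0n ?ler1n.
apply: (@le_trans _ _ (pos_prod (fun d => (if d == k.+1 then k.+1%:R^-1 else 1)
    * pi_factor R d ^+ (k.+2 * k.+3)) v)).
  rewrite [leRHS]pos_prodM pos_prod_point ler_wpM2r //; last by case: ifP.
  by apply: pos_prod_ge0 => d /(pi_factor_bound R)/andP[d0 _]; exact: exprn_ge0.
apply: ler_pos_prod => d hd; have /andP[d0 _] := mem_twos hd.
have /andP[e0 e1] := pi_factor_bound R d0.
have dk : d != k.+2 by apply: contraNneq hk => <-.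
have p1 : pi_factor R d ^+ (k.+2 * k.+3) <= 1 by rewrite exprn_ile1.
apply/andP; split.
  by rewrite mulr_ge0 ?exprn_ge0 //; case: ifP.
rewrite /single_abs; case: eqP => [_|/eqP dk1].
  by rewrite -[leRHS]mulr1 ler_wpM2l.
rewrite mul1r; case: ltnP => // kd.
rewrite /pi_factor ifT; last by lia.
by apply: pow_pi_factor_le; lia.
Qed.

(** If 2 is a position of a 2 then 3 is not, and [single_ge_pi] applies with k = 1, giving exponent
    12 and constant 1/2; otherwise it applies with k = 0 and exponent 6. *)
Lemma pi_fin_single_le v : pi_fin R v ^+ 12 / 2 <= `|single 0 v| + `|single 1 v|.
Proof.
have p0 := pi_fin_ge0 R v; have p1 := pi_fin_le1 R v.
have [h2|h2] := boolP (2%N \in twos v).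
  have := single_ge_pi (twos_gap h2); rewrite mulrC => h.
  by apply: le_trans h _; rewrite lerDr.
have := single_ge_pi h2; rewrite invr1 mul1r => h.
apply: (@le_trans _ _ (`|single 0 v|)); last by rewrite lerDl.
apply: le_trans h; have h12 : pi_fin R v ^+ 12 <= pi_fin R v ^+ 6.
  by rewrite -[12%N]/(6 + 6)%N exprD -[leRHS]mulr1 ler_wpM2l ?exprn_ge0 ?exprn_ile1.
have := exprn_ge0 6 p0; have := exprn_ge0 12 p0.
by rewrite -[(2 * 3)%N]/6%N; lra.
Qed.

(** This yields summability from a lower bound on pi. A new 2 at d, with x = 1/d, turns p s into p(1
    - x)(s + x), which is at most (1 - x) + x. *)
Lemma pi_fin_sum_le v : pi_fin R v * (\sum_(d <- twos v) d%:R^-1) <= 1.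
Proof.
elim: v => [|[] v IH] //=; first by rewrite big_nil mulr0.
rewrite -cats1 big_cat big_seq1; set d := (wrank v).+1.
have -> : pi_fin R (true :: v) = pi_fin R v * pi_factor R d.
  by rewrite !pi_finE pos_prod_two.
have p0 := pi_fin_ge0 R v; have p1 := pi_fin_le1 R v.
have /andP[x0 x1] := invn_bound R (isT : (0 < d)%N).
(* A 2 at position 1 contributes no factor to pi, but then it is the only 2 and the sum is 1. *)
rewrite /pi_factor /d; case: (wrank v) (@wrank_eq0 v) => [/(_ erefl) v0|k _] /=.
  by rewrite v0 !big_nil mulr1 add0r invr1 mulr1 -v0.
move: (pi_fin R v) (\sum_(i <- _) _) (k.+2%:R^-1) IH p0 p1 (invn_bound R (isT : (0 < k.+2)%N)).
move=> p s x IH p0 p1 /andP[y0 y1].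
have h1 : p * s * (1 - x) <= 1 * (1 - x) by rewrite ler_wpM2r ?subr_ge0.
have h2 : 0 <= p * x * x by rewrite !mulr_ge0.
have h3 : p * x <= 1 * x by rewrite ler_wpM2r.
rewrite mul1r in h1; rewrite mul1r in h3.
rewrite (_ : p * (1 - x) * (s + x) = p * s * (1 - x) + p * x - p * x * x); last by ring.
lra.
Qed.

Lemma superadditive_expn (x z : R) k : 0 <= x -> 0 <= z ->
  x ^+ k.+1 + z ^+ k.+1 <= (x + z) ^+ k.+1.
Proof.
move=> x0 z0; elim: k => [|k IH]; first by rewrite !expr1.
rewrite [leRHS]exprS; apply: le_trans (_ : (x + z) * (x ^+ k.+1 + z ^+ k.+1) <= _).
  rewrite mulrDl !mulrDr -!exprS.
  have : 0 <= x * z ^+ k.+1 by rewrite mulr_ge0 // exprn_ge0.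
  have : 0 <= z * x ^+ k.+1 by rewrite mulr_ge0 // exprn_ge0.
  lra.
by rewrite ler_wpM2l // addr_ge0.
Qed.

(** This serves as continuity of roots on the nonnegative reals; it is superadditivity of the power
    at x and y - x. *)
Lemma dist_expn_le (x y : R) k : 0 <= x -> 0 <= y ->
  `|x - y| ^+ k.+1 <= `|x ^+ k.+1 - y ^+ k.+1|.
Proof.
wlog xy : x y / x <= y => [hw|] x0 y0.
  have [xy|/ltW xy] := leP x y; first exact: hw.
  by rewrite distrC [leRHS]distrC; apply: hw.
rewrite distrC [leRHS]distrC !ger0_norm ?subr_ge0 ?lerXn2r ?nnegrE //.
rewrite lerBrDl; have := @superadditive_expn x (y - x) k x0.
by rewrite subr_ge0 (addrC x (y - x)) subrK => /(_ xy).
Qed.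

Lemma is_cvg_expn (f : nat -> R) k : (forall n, 0 <= f n) ->
  cvgn (fun n => f n ^+ k.+1) -> cvgn f.
Proof.
move=> f0 cf; set q := limn (fun n => f n ^+ k.+1).
have q0 : 0 <= q by apply: limr_ge => //; apply: nearW => n; rewrite exprn_ge0.
pose y := q `^ (k.+1%:R^-1).
have y0 : 0 <= y by exact: powR_ge0.
have yk : y ^+ k.+1 = q.
  by rewrite -powR_mulrn // -powRrM mulVf ?pnatr_eq0 // powRr1.
apply: (cvgP y); apply/cvgrPdist_lt => e e0.
have ek : 0 < e ^+ k.+1 by rewrite exprn_gt0.
near=> n; have : `|q - f n ^+ k.+1| < e ^+ k.+1.
  near: n; move: ek; move: (e ^+ k.+1); apply/cvgrPdist_lt; exact: cf.
rewrite -yk => h; have := le_lt_trans (dist_expn_le k y0 (f0 n)) h.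
by rewrite ltr_pXn2r // nnegrE ltW.
Unshelve. all: by end_near. Qed.

Section Converse.
Variables (w : nat -> word) (c : nat -> R).
Hypothesis hw : forall n, (0 < n)%N -> YF n (w n).
Hypothesis hc : forall k, single k (w n) @[n --> \oo] --> c k.

Lemma single_limit0 : c 0 = 0 -> c 1 = 0 -> condition_i R w.
Proof.
move=> c0 c1; have : `|single 0 (w n)| + `|single 1 (w n)| @[n --> \oo] --> (0 : R).
  rewrite -[X in _ --> X](addr0 (0 : R)); apply: cvgD; rewrite -(@normr0 _ R).
    by apply: cvg_norm; rewrite -c0.
  by apply: cvg_norm; rewrite -c1.
move=> /cvgrPdist_lt h; apply/cvgrPdist_lt => e e0.
have e12 : 0 < e ^+ 12 / 2 by rewrite divr_gt0 // exprn_gt0.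
near=> n; have : `|0 - (`|single 0 (w n)| + `|single 1 (w n)|)| < e ^+ 12 / 2.
  by near: n; exact: h.
rewrite !sub0r !normrN [X in X < _]ger0_norm ?addr_ge0 //.
rewrite (ger0_norm (pi_fin_ge0 R _)) => hn.
have := le_lt_trans (pi_fin_single_le (w n)) hn.
by rewrite ltr_pM2r ?invr_gt0 // ltr_pXn2r // nnegrE ?pi_fin_ge0 // ltW.
Unshelve. all: by end_near. Qed.

Variables (a : nat) (ca : c a != 0).

Lemma pi_fin_bounded_below : exists2 e : R, 0 < e &
  \forall n \near \oo, e <= pi_fin R (w n).
Proof.
have ca0 : 0 < `|c a| / 2 by rewrite divr_gt0 // normr_gt0.
have p0 : 0 < 2 ^+ a.+2 :> R by rewrite exprn_gt0.
exists (`|c a| / 2 / 2 ^+ a.+2); first by rewrite divr_gt0.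
have /cvgrPdist_lt/(_ _ ca0) h := @hc a.
apply: filterS h => n h; rewrite ler_pdivrMr // [leRHS]mulrC.
apply: le_trans (single_le_pi a (w n)).
have := ler_normD (c a - single a (w n)) (single a (w n)); rewrite subrK; lra.
Qed.

(** A nonzero limit fixes the sign of [single k] eventually. If c k = 0, the lower bound on pi would
    keep [single k] away from 0 unless k + 2 is a position of a 2, and then k + 1 is not. *)
Lemma mem_twos_eventually k :
  \forall n \near \oo, (k.+1 \in twos (w n)) = (c k < 0).
Proof.
have [e e0 he] := pi_fin_bounded_below.
have sgn v : (k.+1 \in twos v -> single k v <= 0) /\ (k.+1 \notin twos v -> 0 <= single k v).
  have p0 : 0 <= pos_prod (single_abs k) v.
    by apply: pos_prod_ge0 => d _; exact: single_abs_ge0.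
  by rewrite singleE; split=> [->|/negbTE ->]; rewrite ?mulN1r ?oppr_le0 ?mul1r.
case: (ltrgtP (c k) 0) => ck.
- have : \forall n \near \oo, single k (w n) < 0 by exact: (cvgr_lt _ (@hc k) _ ck).
  apply: filterS => n sn; apply/idPn => /(proj2 (sgn _)); by rewrite leNgt sn.
- have : \forall n \near \oo, 0 < single k (w n) by exact: (cvgr_gt _ (@hc k) _ ck).
  apply: filterS => n sn; apply/negbTE/negP => /(proj1 (sgn _)); by rewrite leNgt sn.
- pose b : R := k.+1%:R^-1 * e ^+ (k.+2 * k.+3).
  have b0 : 0 < b by rewrite mulr_gt0 ?invr_gt0 ?ltr0n // exprn_gt0.
  have /cvgrPdist_lt/(_ _ b0) h := @hc k.
  apply: filterS2 he h => n en; rewrite ck sub0r normrN => h.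
  apply/negbTE; have [h2|h2] := boolP (k.+2 \in twos (w n)).
    by apply/negP => /twos_gap; rewrite h2.
  have := le_lt_trans (single_ge_pi h2) h; rewrite ltr_pM2l ?invr_gt0 ?ltr0n //.
  by rewrite ltNge lerXn2r // ?nnegrE ?pi_fin_ge0 // ltW.
Qed.

(** The position of the next digit is one more than the rank of the digits already found, hence the
    recursion through the truncations. *)
Fixpoint limit_trunc (N : nat) : word :=
  if N is N'.+1 then (c (wrank (limit_trunc N')) < 0) :: limit_trunc N' else [::].

Definition limit_word : infword := fun N => c (wrank (limit_trunc N)) < 0.

Lemma trunc_limit_word N : trunc limit_word N = limit_trunc N.
Proof. by elim: N => //= N ->. Qed.

Lemma suffix_converges_limit_word : suffix_converges w limit_word.
Proof.
elim=> [|N IH]; first by apply: nearW => n; exact: suffix0s.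
rewrite trunc_limit_word in IH; rewrite trunc_limit_word /=; set t := limit_trunc N in IH *.
near=> n.
have /suffixP[x xE] : suffix t (w n) by near: n.
have hm : ((wrank t).+1 \in twos (w n)) = (c (wrank t) < 0).
  by near: n; exact: mem_twos_eventually.
(* As [w n] has rank n, it eventually has a digit to the left of [t]. *)
have tn : (wrank t < n)%N by near: n; exact: nbhs_infty_gt.
have wn : wrank (w n) = n by apply: hw; lia.
case/lastP: x xE => [|x b] xE; first by move: tn; rewrite -wn xE ltnn.
move: hm; rewrite xE cat_rcons mem_twos_digit => <-.
by apply/suffixP; exists x.
Unshelve. all: by end_near. Qed.

Lemma condition_ii_limit_word : exists W beta, condition_ii w W (beta : R).
Proof.
have [e e0 he] := pi_fin_bounded_below; have hW := suffix_converges_limit_word.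
set W := limit_word in hW.
(* A truncation is a suffix of some [w n], and pi can only grow when passing to a suffix. *)
have piN N : e <= pi_fin R (trunc W N).
  have [n [en /suffixP[x xE]]] : exists n, e <= pi_fin R (w n) /\ suffix (trunc W N) (w n).
    near \oo => n; exists n; split; near: n => //; exact: hW.
  by apply: le_trans en _; rewrite xE; exact: pi_fin_cat_le.
have cpi : cvgn (fun n => pi_fin R (w n)).
  have [m [mE /(_ W)[M /(_ _ hW) mM]]] := kappa_factorization R (two_ones a).
  rewrite top_two_ones in mE.
  apply: (@is_cvg_expn _ a.+1) => [n|]; first exact: pi_fin_ge0.
  (* Because pi is at most 1, [m (w n)] dominates [single a (w n)], whose limit is nonzero. Dividing
     by [m] then gives the limit of the power a + 2 of pi. *)
  have M0 : M != 0.
    apply: contraNneq ca => M0; apply/eqP.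
    rewrite -(cvg_lim (@norm_hausdorff _ R) (@hc a)); apply: cvg_lim => //.
    apply/norm_cvg0P; apply: (@squeeze_cvgr _ _ _ _ (fun=> 0) (fun n => `|m (w n)|)).
    - apply: nearW => n; rewrite normr_ge0 /single mE normrM ler_piMr //.
      by rewrite normrX exprn_ile1 ?normr_ge0 // ger0_norm ?pi_fin_ge0 ?pi_fin_le1.
    - exact: cvg_cst.
    - by rewrite -(@normr0 _ R); apply: cvg_norm; rewrite -M0.
  apply: (cvgP (c a / M)).
  apply: cvg_trans (cvgM (@hc a) (cvgV M0 mM)); apply: near_eq_cvg.
  have : \forall n \near \oo, m (w n) != 0 by exact: (cvgr_neq0 _ mM M0).
  by apply: filterS => n mn /=; rewrite /single mE mulrAC mulfV // mul1r.
exists W, ((pi_inf R W)^-1 * limn (fun n => pi_fin R (w n))); split=> //.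
- exact/converges_to_suffix.
- apply: nondecreasing_is_cvgn.
    apply/nondecreasing_series => i _ _; case: ifP => // _; by rewrite invr_ge0.
  exists e^-1 => _ [N _ <-].
  have -> : series (fun i => if W i then (wpos W i)%:R^-1 else 0) N =
      \sum_(d <- twos (trunc W N)) d%:R^-1 :> R.
    rewrite /series /= big_mkord; elim: N => [|N IH]; first by rewrite big_ord0 big_nil.
    rewrite big_ord_recr /= IH wposE; case: (W N); rewrite ?addr0 //=.
    by rewrite -cats1 big_cat big_seq1.
  rewrite -[leRHS]mul1r ler_pdivlMr // mulrC.
  apply: le_trans (pi_fin_sum_le (trunc W N)); rewrite ler_wpM2r //.
  by apply: sumr_ge0 => d _; rewrite invr_ge0.
- rewrite mulr_gt0 ?invr_gt0 //.
    apply: lt_le_trans e0 _; rewrite -(cvg_lim (@norm_hausdorff _ R) (@cvg_pi_trunc R W)).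
    by apply: limr_ge; [exact: cvgP (@cvg_pi_trunc R W)|exact: nearW].
  by apply: lt_le_trans e0 _; apply: limr_ge.
Unshelve. all: by end_near. Qed.

End Converse.
End SingleTwo.

(** * From values on the basis p back to the functionals *)

Section Limits.
Variables (R : realType) (w : nat -> word).
Hypothesis hw : forall n, (0 < n)%N -> YF n (w n).
Local Notation evp := (eval_okada (@p_op R)).

Lemma psi_cvg (L : word -> R) :
  (forall u, pos_prod (kappa R u) (w n) @[n --> \oo] --> L u) ->
  forall m (Q : okada), okada_deg m Q ->
    psi R n (w n) (Q * oX ^+ (n - m)) @[n --> \oo] --> evp L Q.
Proof.
move=> hL m Q hQ; have hE := @eval_okada_cvg R (@p_op R) _ _ Q (@p_op_cvg R) hL.
apply: cvg_trans hE; apply: near_eq_cvg; near=> n.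
have n0 : (0 < n)%N by near: n; exact: nbhs_infty_gt.
have mn : (m <= n)%N by near: n; exact: nbhs_infty_ge.
by rewrite (psi_expand R (hw n0) mn hQ).
Unshelve. all: by end_near. Qed.

Lemma regular_of_kappa_cvg (L : word -> R) :
  (forall u, pos_prod (kappa R u) (w n) @[n --> \oo] --> L u) ->
  regular (fun n => psi R n (w n)).
Proof.
move=> hL; exists (evp L); split; first exact: eval_okada_linear.
by move=> m Q; exact: psi_cvg.
Qed.

Lemma kappa_cvg_of_regular (phi : okada -> R) :
  (forall m (Q : okada), okada_deg m Q ->
    psi R n (w n) (Q * oX ^+ (n - m)) @[n --> \oo] --> phi Q) ->
  forall u, pos_prod (kappa R u) (w n) @[n --> \oo] --> phi (okada_p u).
Proof.
move=> h u; apply: cvg_trans (h _ _ (@okada_deg_p u)); apply: near_eq_cvg; near=> n.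
have n0 : (0 < n)%N by near: n; exact: nbhs_infty_gt.
have mn : (wrank u <= n)%N by near: n; exact: nbhs_infty_ge.
by rewrite (psi_expand R (hw n0) mn (@okada_deg_p u)) (rb_eval (right_basis_p R)).
Unshelve. all: by end_near. Qed.

Lemma evp_phi_P Q : evp (fun u => (true \notin u)%:R) Q = phi_P R Q.
Proof.
rewrite [RHS](linear_on_evalT (right_basis_p R)); last first.
  by rewrite /phi_P (functionalT (right_basis_s R)); exact: eval_okada_linear.
by congr (eval_okada _ _ Q); apply/funext => u; rewrite -phi_P_p.
Qed.

Lemma evp_phi_beta_w beta W Q :
  evp (fun u => beta ^+ top u * phi_w_val R W u) Q = phi_beta_w beta W Q.
Proof.
rewrite [RHS](linear_on_evalT (right_basis_p R)); last first.
  by rewrite /phi_beta_w (functionalT (right_basis_s R)); exact: eval_okada_linear.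
by congr (eval_okada _ _ Q); apply/funext => u; rewrite -phi_beta_w_p.
Qed.

End Limits.

Theorem theorem8p5 (R : realType) (w : nat -> word)
    (hw : forall n : nat, (0 < n)%N -> YF n (w n)) :
  [/\ regularity_conditions R w -> regular (fun n => psi R n (w n)),
      condition_i R w ->
        forall (m : nat) (Q : okada), (1 <= m)%N -> okada_deg m Q ->
          psi R n (w n) (Q * oX ^+ (n - m)) @[n --> \oo] --> phi_P R Q,
      forall (W : infword) (beta : R), condition_ii w W beta ->
        forall (m : nat) (Q : okada), (1 <= m)%N -> okada_deg m Q ->
          psi R n (w n) (Q * oX ^+ (n - m)) @[n --> \oo]
            --> phi_beta_w beta W Q
    & regular (fun n => psi R n (w n)) -> regularity_conditions R w].
Proof.
split.
- case=> [hi|[W [beta hii]]].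
    by apply: (regular_of_kappa_cvg hw) => u; exact: kappa_cvg_i.
  by apply: (regular_of_kappa_cvg hw) => u; exact: kappa_cvg_ii hii.
- move=> hi m Q _ hQ; rewrite -evp_phi_P.
  by apply: (psi_cvg hw _ hQ) => u; exact: kappa_cvg_i.
- move=> W beta hii m Q _ hQ; rewrite -evp_phi_beta_w.
  by apply: (psi_cvg hw _ hQ) => u; exact: kappa_cvg_ii hii.
- case=> phi [_ /(kappa_cvg_of_regular hw) hphi].
  have hc k : single R k (w n) @[n --> \oo] --> phi (okada_p (two_ones k)) by exact: hphi.
  have [c0|c0] := eqVneq (phi (okada_p (two_ones 0))) 0; last first.
    by right; exact: (condition_ii_limit_word hw hc c0).
  have [c1|c1] := eqVneq (phi (okada_p (two_ones 1))) 0; last first.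
    by right; exact: (condition_ii_limit_word hw hc c1).
  by left; exact: (single_limit0 hc c0 c1).
Qed.
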